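(* Consider the observer-based event-triggered boundary control strategy described in the context with arbitrary $\eta,\rho>0$, $m(0)<0$, $\sigma\in(0,1)$, and $\beta_i=\alpha_i/(1-\sigma)$ for $i=1,2,3$, where $\alpha_1,\alpha_2,\alpha_3$ (and $\rho_1$) are the constants given in the context. Then for all $j$, $t_{j+1}-t_j\ge\tau$, where $$\tau=\int_0^1\frac{ds}{a_1s^2+a_2s+a_3}>0,\qquad a_1=\sigma\rho,\ a_2=1+\rho_1+2(1-\sigma)\rho+\eta,\ a_3=\big(1+\rho_1+(1-\sigma)\rho+\eta\big)\frac{1-\sigma}{\sigma}.$$ In particular there is a minimal dwell-time independent of the initial conditions, depending only on the system and control parameters.
   Context: Setup. $\varepsilon,\lambda>0$, $q>(\lambda+\varepsilon)/(2\varepsilon)$, $r=q-\lambda/(2\varepsilon)$. $I_m,J_m$ are the modified and ordinary Bessel functions of the first kind (with $I_1(z)/z,J_1(z)/z\to1/2$ at $z=0$). Kernels on $0\le y\le x\le1$: $P(x,y)=\frac{q\lambda/\varepsilon}{\sqrt{\lambda/\varepsilon+q^2}}\int_0^{x-y}e^{-q\tau/2}I_0\big(\sqrt{\lambda(2-x-y)(x-y-\tau)/\varepsilon}\big)\sinh\big(\tfrac{\sqrt{\lambda/\varepsilon+q^2}}{2}\tau\big)d\tau-\frac{\lambda}{\varepsilon}(1-y)\frac{I_1(\sqrt{\lambda((1-y)^2-(1-x)^2)/\varepsilon})}{\sqrt{\lambda((1-y)^2-(1-x)^2)/\varepsilon}}$; $Q(x,y)=\frac{q\lambda/\varepsilon}{\sqrt{q^2-\lambda/\varepsilon}}\int_0^{x-y}e^{-q\tau/2}J_0\big(\sqrt{\lambda(2-x-y)(x-y-\tau)/\varepsilon}\big)\sinh\big(\tfrac{\sqrt{q^2-\lambda/\varepsilon}}{2}\tau\big)d\tau-\frac{\lambda}{\varepsilon}(1-y)\frac{J_1(\sqrt{\lambda((1-y)^2-(1-x)^2)/\varepsilon})}{\sqrt{\lambda((1-y)^2-(1-x)^2)/\varepsilon}}$;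 $K(x,y)=-\frac{\lambda}{\varepsilon}x\frac{I_1(\sqrt{\lambda(x^2-y^2)/\varepsilon})}{\sqrt{\lambda(x^2-y^2)/\varepsilon}}$, $L(x,y)=-\frac{\lambda}{\varepsilon}x\frac{J_1(\sqrt{\lambda(x^2-y^2)/\varepsilon})}{\sqrt{\lambda(x^2-y^2)/\varepsilon}}$. Gains $p_1(x)=\varepsilon P_y(x,0)$, $p_{10}=-\lambda/(2\varepsilon)$. Let $k(y)=rK(1,y)+K_x(1,y)$. Closed loop: plant $u_t=\varepsilon u_{xx}+\lambda u$, $u_x(0,t)=0$, $u_x(1,t)+qu(1,t)=U_j$; observer $\hat u_t=\varepsilon\hat u_{xx}+\lambda\hat u+p_1(x)(u(0,t)-\hat u(0,t))$, $\hat u_x(0,t)=p_{10}(u(0,t)-\hat u(0,t))$, $\hat u_x(1,t)+q\hat u(1,t)=U_j$, for $t\in[t_j,t_{j+1})$, with $U_j=\int_0^1k(y)\hat u(y,t_j)dy$. Set $\tilde u=u-\hat u$, $\tilde w(x,t)=\tilde u(x,t)+\int_0^xQ(x,y)\tilde u(y,t)dy$, $\hat w(x,t)=\hat u(x,t)-\int_0^xK(x,y)\hat u(y,t)dy$. Event trigger: fix $\eta,\rho,\beta_1,\beta_2,\beta_3>0$, $t_0=0$. Given $t_j$: if $\{t>t_j: d^2(t)>-m(t)\}$ is empty, there are no further events; otherwise $t_{j+1}=\inf\{t>t_j: d^2(t)>-m(t)\}$. Here $d(t)=\int_0^1k(y)(\hat u(y,t_j)-\hat u(y,t))dy$ for $t\in[t_j,t_{j+1})$,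 and $m$ is continuous with $m(0)<0$ and satisfies on each $(t_j,t_{j+1})$ $\dot m=-\eta m+\rho d^2-\beta_1\|\hat w[t]\|^2-\beta_2|\hat w(1,t)|^2-\beta_3|\tilde w(0,t)|^2.$ Constants: $\rho_1=6\varepsilon^2k(1)^2$; $\alpha_1=3\big(1+(\int_0^1\int_0^xL^2dydx)^{1/2}\big)^2\int_0^1(\varepsilon k''(y)+\varepsilon k(1)k(y)+\lambda k(y))^2dy+6(\varepsilon qk(1)+\varepsilon k'(1))^2\int_0^1L^2(1,y)dy$; $\alpha_2=6(\varepsilon qk(1)+\varepsilon k'(1))^2$; $\alpha_3=6\big(\frac{\lambda k(0)}{2}+\int_0^1k(y)p_1(y)dy\big)^2$. *)

(* Defs.v *)
From Stdlib Require Import Reals Factorial.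
From Coquelicot Require Import Coquelicot.
Open Scope R_scope.

Definition BesselI (n : nat) (z : R) : R :=
  Series (fun k => (z / 2) ^ (2 * k + n) / (INR (fact k) * INR (fact (k + n)))).
Definition BesselJ (n : nat) (z : R) : R :=
  Series (fun k => (-1) ^ k * (z / 2) ^ (2 * k + n) / (INR (fact k) * INR (fact (k + n)))).

(* The kernels only use I_0(sqrt w), I_1(sqrt w)/sqrt w, J_0(sqrt w), J_1(sqrt w)/sqrt w
   with w >= 0.  We use their (entire) power series in w, which coincide with these
   expressions for w >= 0 (and with the limit 1/2 at w = 0). *)
Definition I0sq (w : R) : R := Series (fun k => (w / 4) ^ k / (INR (fact k) * INR (fact k))).
Definition I1sq (w : R) : R :=
  / 2 * Series (fun k => (w / 4) ^ k / (INR (fact k) * INR (fact (S k)))).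
Definition J0sq (w : R) : R := Series (fun k => (- w / 4) ^ k / (INR (fact k) * INR (fact k))).
Definition J1sq (w : R) : R :=
  / 2 * Series (fun k => (- w / 4) ^ k / (INR (fact k) * INR (fact (S k)))).

Definition Pk (eps lam q x y : R) : R :=
  q * (lam / eps) / sqrt (lam / eps + q ^ 2) *
    RInt (fun tau => exp (- q * tau / 2) * I0sq (lam * (2 - x - y) * (x - y - tau) / eps)
                      * sinh (sqrt (lam / eps + q ^ 2) / 2 * tau)) 0 (x - y)
  - lam / eps * (1 - y) * I1sq (lam * ((1 - y) ^ 2 - (1 - x) ^ 2) / eps).

Definition Qk (eps lam q x y : R) : R :=
  q * (lam / eps) / sqrt (q ^ 2 - lam / eps) *
    RInt (fun tau => exp (- q * tau / 2) * J0sq (lam * (2 - x - y) * (x - y - tau) / eps)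
                      * sinh (sqrt (q ^ 2 - lam / eps) / 2 * tau)) 0 (x - y)
  - lam / eps * (1 - y) * J1sq (lam * ((1 - y) ^ 2 - (1 - x) ^ 2) / eps).

Definition Kk (eps lam x y : R) : R := - (lam / eps) * x * I1sq (lam * (x ^ 2 - y ^ 2) / eps).
Definition Lk (eps lam x y : R) : R := - (lam / eps) * x * J1sq (lam * (x ^ 2 - y ^ 2) / eps).

Definition rr (eps lam q : R) : R := q - lam / (2 * eps).
Definition p1 (eps lam q x : R) : R := eps * Derive (fun y => Pk eps lam q x y) 0.
Definition p10 (eps lam : R) : R := - lam / (2 * eps).

Definition kg (eps lam q y : R) : R :=
  rr eps lam q * Kk eps lam 1 y + Derive (fun x => Kk eps lam x y) 1.
Definition dkg (eps lam q y : R) : R := Derive (kg eps lam q) y.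
Definition ddkg (eps lam q y : R) : R := Derive (dkg eps lam q) y.

Definition rho1 (eps lam q : R) : R := 6 * eps ^ 2 * (kg eps lam q 1) ^ 2.
Definition alpha1 (eps lam q : R) : R :=
  3 * (1 + sqrt (RInt (fun x => RInt (fun y => (Lk eps lam x y) ^ 2) 0 x) 0 1)) ^ 2
    * RInt (fun y => (eps * ddkg eps lam q y + eps * kg eps lam q 1 * kg eps lam q y
                      + lam * kg eps lam q y) ^ 2) 0 1
  + 6 * (eps * q * kg eps lam q 1 + eps * dkg eps lam q 1) ^ 2
    * RInt (fun y => (Lk eps lam 1 y) ^ 2) 0 1.
Definition alpha2 (eps lam q : R) : R :=
  6 * (eps * q * kg eps lam q 1 + eps * dkg eps lam q 1) ^ 2.
Definition alpha3 (eps lam q : R) : R :=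
  6 * (lam * kg eps lam q 0 / 2 + RInt (fun y => kg eps lam q y * p1 eps lam q y) 0 1) ^ 2.

Definition dwell_tau (eps lam q eta rho sigma : R) : R :=
  let a1 := sigma * rho in
  let a2 := 1 + rho1 eps lam q + 2 * (1 - sigma) * rho + eta in
  let a3 := (1 + rho1 eps lam q + (1 - sigma) * rho + eta) * (1 - sigma) / sigma in
  RInt (fun s => / (a1 * s ^ 2 + a2 * s + a3)) 0 1.

Definition deriv01 (f : R -> R) (x l : R) : Prop :=
  filterlim (fun h => (f (x + h) - f x) / h)
    (within (fun h => h <> 0 /\ 0 <= x + h <= 1) (locally 0)) (locally l).

Definition cont_on (D : R * R -> Prop) (f : R -> R -> R) : Prop :=
  forall p : R * R, D p ->
    filterlim (fun z : R * R => f (fst z) (snd z)) (within D (locally p))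
              (locally (f (fst p) (snd p))).

Definition strip_closed (s : R) (p : R * R) : Prop := 0 <= fst p <= 1 /\ s <= snd p.
Definition strip_open (s : R) (p : R * R) : Prop := 0 <= fst p <= 1 /\ s < snd p.

Definition C21 (s : R) (f fx fxx ft : R -> R -> R) : Prop :=
  (forall x t, 0 <= x <= 1 -> s < t ->
     deriv01 (fun z => f z t) x (fx x t) /\
     deriv01 (fun z => fx z t) x (fxx x t) /\
     is_derive (fun r => f x r) t (ft x t)) /\
  cont_on (strip_closed s) f /\ cont_on (strip_open s) fx /\
  cont_on (strip_open s) fxx /\ cont_on (strip_open s) ft.

Definition held_solution (eps lam q s U : R) (u uh : R -> R -> R) : Prop :=
  exists ux uxx ut uhx uhxx uht : R -> R -> R,
    C21 s u ux uxx ut /\ C21 s uh uhx uhxx uht /\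
    forall t, s < t ->
      (forall x, 0 < x < 1 ->
         ut x t = eps * uxx x t + lam * u x t /\
         uht x t = eps * uhxx x t + lam * uh x t + p1 eps lam q x * (u 0 t - uh 0 t)) /\
      ux 0 t = 0 /\ ux 1 t + q * u 1 t = U /\
      uhx 0 t = p10 eps lam * (u 0 t - uh 0 t) /\ uhx 1 t + q * uh 1 t = U.

Definition what (eps lam : R) (uh : R -> R -> R) (x t : R) : R :=
  uh x t - RInt (fun y => Kk eps lam x y * uh y t) 0 x.
Definition wtil (eps lam q : R) (u uh : R -> R -> R) (x t : R) : R :=
  (u x t - uh x t) + RInt (fun y => Qk eps lam q x y * (u y t - uh y t)) 0 x.
Definition sqnorm01 (f : R -> R) : R := RInt (fun x => (f x) ^ 2) 0 1.

Definition Uctrl (eps lam q : R) (uh : R -> R -> R) (s : R) : R :=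
  RInt (fun y => kg eps lam q y * uh y s) 0 1.
Definition dev (eps lam q : R) (uh : R -> R -> R) (s t : R) : R :=
  RInt (fun y => kg eps lam q y * (uh y s - uh y t)) 0 1.

(* The whole closed loop with the dynamic event trigger.
   tev j : event times (p_infty = "no such event").  For each finite event time t_j,
   (u j, uh j) is the closed-loop solution with input U_j held from t_j on and m j is
   the corresponding solution of the trigger ODE; t_{j+1} is the first triggering time
   of that branch, and the state / m are continuous across events. *)
Definition ETC_closed_loop (eps lam q eta rho b1 b2 b3 : R) (tev : nat -> Rbar)
    (u uh : nat -> R -> R -> R) (m : nat -> R -> R) : Prop :=
  tev O = Finite 0 /\ m O 0 < 0 /\
  forall j : nat,
    match tev j with
    | Finite tj =>
        held_solution eps lam q tj (Uctrl eps lam q (uh j) tj) (u j) (uh j) /\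
        filterlim (m j) (at_right tj) (locally (m j tj)) /\
        (forall t, tj < t ->
           is_derive (m j) t
             (- eta * m j t + rho * (dev eps lam q (uh j) tj t) ^ 2
              - b1 * sqnorm01 (fun x => what eps lam (uh j) x t)
              - b2 * (what eps lam (uh j) 1 t) ^ 2
              - b3 * (wtil eps lam q (u j) (uh j) 0 t) ^ 2)) /\
        tev (S j) = Glb_Rbar (fun t => tj < t /\ - m j t < (dev eps lam q (uh j) tj t) ^ 2) /\
        (forall tj1, tev (S j) = Finite tj1 ->
           m (S j) tj1 = m j tj1 /\
           forall x, 0 <= x <= 1 -> u (S j) x tj1 = u j x tj1 /\ uh (S j) x tj1 = uh j x tj1)
    | _ => tev (S j) = p_infty
    end.

(* Main.v *)
(* The ratio [psi = (d^2 + (1 - sigma) m) / (- sigma m)] is negative right after an event and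
   equals [1] at the next one, where [d^2 = - m].  Differentiating [d] under the integral,
   inserting the observer equation and integrating by parts twice (the gain [k] is even, so
   [k' 0 = 0]) expresses [d'] through [d], [uh], [uh 1] and [u 0 - uh 0 = wt 0]; the inverse
   transformation [uh = wh + int L wh] then yields
     [d'^2 <= rho1 d^2 + alpha1 |wh|^2 + alpha2 (wh 1)^2 + alpha3 (wt 0)^2].
   With [beta_i = alpha_i / (1 - sigma)] the last three terms cancel against those of [m'], which
   leaves [psi' <= a1 psi^2 + a2 psi + a3] as long as [psi >= 0].

   That [L] inverts [K] amounts to
     [int_0^W j (W - v) i v dv = 2 (i W - j W)],   [i v = I_1 (sqrt v) / sqrt v],
                                                   [j v = J_1 (sqrt v) / sqrt v],
   which follows by integrating the derivative of
     [(W - v) j (W - v) I_0 (sqrt v) + J_0 (sqrt (W - v)) v i v]. *)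

(* Derivatives of the state are available only on [[0, 1]] and strictly after an event; at the event
   itself there is mere continuity. Two devices follow from this. Spatial profiles are extended by
   constants to the whole line, so that one global notion of continuity serves every integral. The
   comparison argument is run on an interval that starts slightly after the event, which only
   strengthens the bound.

   The quotient [psi] makes sense only while [m < 0], and this has to be secured before [psi] is
   used: until the trigger fires [d^2 <= - m], so [m' <= - (eta + rho) m], and [m] keeps its sign up
   to and including the next event. Continuity of [m] across events hands the sign to the following
   interval.

   The cancellation of the forcing terms uses [psi >= 0], so time is counted only from the last zero
   of [psi]. *)
Require Import Defs.
From Stdlib Require Import Reals Factorial Lra Lia.
From Coquelicot Require Import Coquelicot.
Open Scope R_scope.

(** * Integrals of real functions *)

(* Coquelicot states these equalities in the carrier of a normed module, where [ring] does not
   recognize [R]. *)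
Ltac eq_R := lazymatch goal with |- @eq _ ?a ?b => change (@eq R a b) end.

Lemma RInt_Rplus (f g : R -> R) (a b : R) : ex_RInt f a b -> ex_RInt g a b ->
  RInt (fun x => f x + g x) a b = RInt f a b + RInt g a b.
Proof. exact (@RInt_plus R_CompleteNormedModule f g a b). Qed.

Lemma RInt_Rminus (f g : R -> R) (a b : R) : ex_RInt f a b -> ex_RInt g a b ->
  RInt (fun x => f x - g x) a b = RInt f a b - RInt g a b.
Proof. exact (@RInt_minus R_CompleteNormedModule f g a b). Qed.

Lemma RInt_Rscal (f : R -> R) (c a b : R) : ex_RInt f a b ->
  RInt (fun x => c * f x) a b = c * RInt f a b.
Proof. exact (@RInt_scal R_CompleteNormedModule f a b c). Qed.

Lemma RInt_Rext (f g : R -> R) (a b : R) : (forall x, a <= x <= b -> f x = g x) -> a <= b ->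
  RInt f a b = RInt g a b.
Proof.
  intros H Hab. apply RInt_ext. intros x. rewrite Rmin_left, Rmax_right by exact Hab.
  intros Hx. apply H. lra.
Qed.

Lemma ex_RInt_Rext (f g : R -> R) (a b : R) : (forall x, a <= x <= b -> f x = g x) -> a <= b ->
  ex_RInt f a b -> ex_RInt g a b.
Proof.
  intros H Hab. apply ex_RInt_ext. intros x. rewrite Rmin_left, Rmax_right by exact Hab.
  intros Hx. apply H. lra.
Qed.

Lemma ex_RInt_Rplus (f g : R -> R) (a b : R) : ex_RInt f a b -> ex_RInt g a b ->
  ex_RInt (fun x => f x + g x) a b.
Proof. exact (@ex_RInt_plus R_CompleteNormedModule f g a b). Qed.

Lemma ex_RInt_Rscal (f : R -> R) (c a b : R) : ex_RInt f a b ->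
  ex_RInt (fun x => c * f x) a b.
Proof. exact (@ex_RInt_scal R_CompleteNormedModule f a b c). Qed.

Lemma ex_RInt_cont (f : R -> R) (a b : R) : (forall x, continuous f x) -> ex_RInt f a b.
Proof. intros H. apply (@ex_RInt_continuous R_CompleteNormedModule). intros x _. apply H. Qed.

Lemma cont_Rplus (f g : R -> R) (x : R) : continuous f x -> continuous g x ->
  continuous (fun y => f y + g y) x.
Proof. exact (@continuous_plus _ _ R_NormedModule f g x). Qed.

Lemma cont_Rminus (f g : R -> R) (x : R) : continuous f x -> continuous g x ->
  continuous (fun y => f y - g y) x.
Proof. exact (@continuous_minus _ _ R_NormedModule f g x). Qed.

Lemma cont_Rmult (f g : R -> R) (x : R) : continuous f x -> continuous g x ->
  continuous (fun y => f y * g y) x.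
Proof. exact (@continuous_mult _ R_AbsRing f g x). Qed.

Lemma cont_ext (f g : R -> R) (x : R) : (forall y, f y = g y) -> continuous f x -> continuous g x.
Proof. exact (@continuous_ext R_UniformSpace R_UniformSpace f g x). Qed.

Lemma cont_pow2 (f : R -> R) (x : R) : continuous f x -> continuous (fun y => (f y) ^ 2) x.
Proof.
  intros H. apply cont_ext with (fun y => f y * f y); [intros; ring|].
  now apply cont_Rmult.
Qed.

Lemma is_derive_continuous (f : R -> R) (x l : R) : is_derive f x l -> continuous f x.
Proof. intros H. apply (@ex_derive_continuous R_AbsRing R_NormedModule). now exists l. Qed.

Lemma continuity_2d_snd (f : R -> R -> R) (x y : R) : continuity_2d_pt f x y ->
  continuous (fun v => f x v) y.
Proof.
  intros H. apply filterlim_locally. intros e. destruct (H e) as [d Hd].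
  exists d. intros v Hv. apply Hd; [|exact Hv].
  rewrite Rminus_eq_0, Rabs_R0. apply cond_pos.
Qed.

Lemma continuity_2d_fst (f : R -> R -> R) (x y : R) : continuity_2d_pt f x y ->
  continuous (fun u => f u y) x.
Proof.
  intros H. apply filterlim_locally. intros e. destruct (H e) as [d Hd].
  exists d. intros v Hv. apply Hd; [exact Hv|].
  rewrite Rminus_eq_0, Rabs_R0. apply cond_pos.
Qed.

Lemma Derive_eta (f : R -> R) (x l : R) : is_derive f x l -> Derive (fun y : R => f y) x = l.
Proof. apply is_derive_unique. Qed.

(* The quadratic [t |-> int (f - t g)^2] is nonnegative, hence its discriminant is not positive. *)
Lemma RInt_cauchy_schwarz (f g : R -> R) (a b : R) : a <= b ->
  (forall x, continuous f x) -> (forall x, continuous g x) ->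
  (RInt (fun x => f x * g x) a b) ^ 2
    <= RInt (fun x => (f x) ^ 2) a b * RInt (fun x => (g x) ^ 2) a b.
Proof.
  intros Hab Cf Cg.
  assert (Hf : ex_RInt (fun x => (f x) ^ 2) a b) by (apply ex_RInt_cont; intros; now apply cont_pow2).
  assert (Hg : ex_RInt (fun x => (g x) ^ 2) a b) by (apply ex_RInt_cont; intros; now apply cont_pow2).
  assert (Hfg : ex_RInt (fun x => f x * g x) a b) by (apply ex_RInt_cont; intros; now apply cont_Rmult).
  set (A := RInt (fun x => (f x) ^ 2) a b : R). set (B := RInt (fun x => f x * g x) a b : R).
  set (C := RInt (fun x => (g x) ^ 2) a b : R).
  assert (HA : 0 <= A) by (apply RInt_ge_0; auto; intros; apply pow2_ge_0).
  assert (HC : 0 <= C) by (apply RInt_ge_0; auto; intros; apply pow2_ge_0).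
  assert (Hq : forall s t, 0 <= s * s * A + 2 * s * t * B + t * t * C).
  { intros s t.
    replace (s * s * A + 2 * s * t * B + t * t * C)
      with (RInt (fun x => (s * f x + t * g x) ^ 2) a b).
    - apply RInt_ge_0; auto.
      + apply ex_RInt_Rext with
          (fun x => (s * s) * (f x) ^ 2 + ((2 * s * t) * (f x * g x) + (t * t) * (g x) ^ 2)).
        * intros; ring.
        * exact Hab.
        * apply ex_RInt_Rplus; [|apply ex_RInt_Rplus]; now apply ex_RInt_Rscal.
      + intros; apply pow2_ge_0.
    - rewrite (RInt_Rext _
          (fun x => (s * s) * (f x) ^ 2 + ((2 * s * t) * (f x * g x) + (t * t) * (g x) ^ 2)))
        by (intros; ring || exact Hab).
      rewrite RInt_Rplus, RInt_Rplus, !RInt_Rscal; auto.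
      + unfold A, B, C. eq_R. ring.
      + now apply ex_RInt_Rscal.
      + now apply ex_RInt_Rscal.
      + now apply ex_RInt_Rscal.
      + apply ex_RInt_Rplus; now apply ex_RInt_Rscal. }
  destruct (Req_dec C 0) as [HC0|HC0].
  - destruct (Req_dec B 0) as [HB|HB]; [rewrite HB, HC0; lra|].
    (* With [C = 0] the form at [s = 1] is [A + 2 t B], affine in [t]; this [t] gives it the value
       [-1]. *)
    exfalso. pose proof (Hq 1 (- (A + 1) / (2 * B))) as H3. rewrite HC0 in H3.
    replace (1 * 1 * A + 2 * 1 * (- (A + 1) / (2 * B)) * B + _) with (-1) in H3
      by (field; auto).
    lra.
  (* At [(C, - B)] the form equals [C (A C - B^2)], and [C > 0] can be divided out. *)
  - pose proof (Hq C (- B)) as H1. apply Rmult_le_reg_l with C; [lra|].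
    replace (C * (A * C)) with (C * C * A) by ring.
    replace (C * C * A + 2 * C * - B * B + - B * - B * C)
      with (C * C * A - C * B ^ 2) in H1 by ring.
    lra.
Qed.

(** * The entire series behind the Bessel functions *)

Lemma PSeries_entire_derive (a : nat -> R) (x : R) : CV_radius a = p_infty ->
  is_derive (PSeries a) x (PSeries (PS_derive a) x).
Proof. intros H. apply is_derive_PSeries. now rewrite H. Qed.

Lemma PSeries_entire_continuous (a : nat -> R) (x : R) : CV_radius a = p_infty ->
  continuous (PSeries a) x.
Proof. intros H. eapply is_derive_continuous. now apply PSeries_entire_derive. Qed.

(** The sign [s] treats both Bessel families at once: [bes0] has the coefficients of [I_0 (sqrt w)]
    for [s = 1] and of [J_0 (sqrt w)] for [s = -1]; [bes1] likewise those of [I_1 (sqrt w) / sqrt w]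
    and [J_1 (sqrt w) / sqrt w]. As power series in [w] they can be differentiated at [w = 0]
    too. *)
Definition bes0 (s : R) (k : nat) : R := (s / 4) ^ k / (INR (fact k) * INR (fact k)).
Definition bes1 (s : R) (k : nat) : R := / 2 * ((s / 4) ^ k / (INR (fact k) * INR (fact (S k)))).

Lemma bes0_derive (s : R) (k : nat) : PS_derive (bes0 s) k = s / 2 * bes1 s k.
Proof.
  unfold PS_derive, bes0, bes1. rewrite fact_simpl, mult_INR. simpl pow.
  pose proof (INR_fact_neq_0 k). assert (INR (S k) <> 0) by (apply not_0_INR; lia).
  field. auto.
Qed.

(** The classical [(z I_1)' = z I_0] and [(z J_1)' = z J_0], read in the variable [w = z^2]. *)
Lemma bes1_incr_derive (s : R) (k : nat) : PS_derive (PS_incr_1 (bes1 s)) k = / 2 * bes0 s k.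
Proof.
  unfold PS_derive, PS_incr_1, bes0, bes1. rewrite fact_simpl, mult_INR.
  pose proof (INR_fact_neq_0 k). assert (INR (S k) <> 0) by (apply not_0_INR; lia).
  field. auto.
Qed.

Lemma bes0_radius (s : R) : s <> 0 -> CV_radius (bes0 s) = p_infty.
Proof.
  intros Hs. apply CV_radius_infinite_DAlembert.
  - intros n. unfold bes0. pose proof (INR_fact_neq_0 n).
    apply Rmult_integral_contrapositive_currified.
    + apply pow_nonzero; lra.
    + apply Rinv_neq_0_compat; nra.
  - apply is_lim_seq_ext with (fun n => Rabs (s / 4) * (/ INR (S n) * / INR (S n))).
    + intros n. unfold bes0. rewrite fact_simpl, mult_INR. simpl pow.
      pose proof (INR_fact_neq_0 n). assert (Hn : 0 < INR (S n)) by (apply lt_0_INR; lia).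
      rewrite <- (Rabs_pos_eq (/ INR (S n) * / INR (S n))).
      * rewrite <- Rabs_mult. f_equal. field. repeat split; try lra; auto.
        apply pow_nonzero; lra.
      * apply Rlt_le, Rmult_lt_0_compat; now apply Rinv_0_lt_compat.
    + assert (Hi : is_lim_seq (fun n => / INR (S n)) 0).
      { apply (is_lim_seq_incr_1 (fun n => / INR n)).
        change (Finite 0) with (Rbar_inv p_infty).
        apply is_lim_seq_inv; [apply is_lim_seq_INR|discriminate]. }
      replace 0 with (Rabs (s / 4) * (0 * 0)) by ring.
      apply (is_lim_seq_scal_l _ _ (Finite (0 * 0))). apply is_lim_seq_mult'; auto.
Qed.

Lemma bes1_radius (s : R) : s <> 0 -> CV_radius (bes1 s) = p_infty.
Proof.
  intros Hs. rewrite <- (bes0_radius s Hs), <- (CV_radius_derive (bes0 s)).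
  rewrite (CV_radius_ext (PS_derive (bes0 s)) (PS_scal (s / 2) (bes1 s))) by apply bes0_derive.
  symmetry. apply CV_radius_scal. lra.
Qed.

Definition B0 (s w : R) : R := PSeries (bes0 s) w.
Definition B1 (s w : R) : R := PSeries (bes1 s) w.

Lemma is_derive_B0 (s w : R) : s <> 0 -> is_derive (B0 s) w (s / 2 * B1 s w).
Proof.
  intros Hs. unfold B1. rewrite <- PSeries_scal.
  rewrite (PSeries_ext _ (PS_derive (bes0 s))) by (intros; symmetry; apply bes0_derive).
  apply PSeries_entire_derive, bes0_radius, Hs.
Qed.

Lemma is_derive_id_B1 (s w : R) : s <> 0 -> is_derive (fun w => w * B1 s w) w (/ 2 * B0 s w).
Proof.
  intros Hs. unfold B0. rewrite <- PSeries_scal.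
  rewrite (PSeries_ext _ (PS_derive (PS_incr_1 (bes1 s))))
    by (intros; symmetry; apply bes1_incr_derive).
  apply is_derive_ext with (PSeries (PS_incr_1 (bes1 s))).
  - intros t. apply PSeries_incr_1.
  - apply PSeries_entire_derive. rewrite CV_radius_incr_1. now apply bes1_radius.
Qed.

Lemma B1_continuous (s w : R) : s <> 0 -> continuous (B1 s) w.
Proof. intros Hs. now apply PSeries_entire_continuous, bes1_radius. Qed.

Lemma I1sq_B1 (w : R) : I1sq w = B1 1 w.
Proof.
  unfold I1sq, B1, PSeries. rewrite <- Series_scal_l. apply Series_ext. intros n.
  unfold bes1. unfold Rdiv. rewrite !Rpow_mult_distr. rewrite pow1. ring.
Qed.

Lemma J1sq_B1 (w : R) : J1sq w = B1 (-1) w.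
Proof.
  unfold J1sq, B1, PSeries. rewrite <- Series_scal_l. apply Series_ext. intros n.
  unfold bes1. replace (- w / 4) with (-1 / 4 * w) by field.
  rewrite Rpow_mult_distr. field. split; apply INR_fact_neq_0.
Qed.

(** The two products of [B0] have opposite signs and cancel; the two products of [B1] carry
    [(W - v) / 2] and [v / 2], which add up to the constant [W / 2]. *)
Lemma bessel_convolution_derive (W v : R) :
  is_derive (fun v => (W - v) * B1 (-1) (W - v) * B0 1 v + B0 (-1) (W - v) * (v * B1 1 v)) v
    (W / 2 * (B1 (-1) (W - v) * B1 1 v)).
Proof.
  assert (Hs : is_derive (fun v => W - v) v (-1)) by (auto_derive; [auto|ring]).
  assert (H1 : is_derive (fun v => (W - v) * B1 (-1) (W - v)) v (-1 * (/ 2 * B0 (-1) (W - v)))).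
  { apply (is_derive_comp (fun w => w * B1 (-1) w) (fun v => W - v)); [|exact Hs].
    apply is_derive_id_B1. lra. }
  assert (H2 : is_derive (fun v => B0 (-1) (W - v)) v (-1 * (-1 / 2 * B1 (-1) (W - v)))).
  { apply (is_derive_comp (B0 (-1)) (fun v => W - v)); [|exact Hs].
    apply is_derive_B0. lra. }
  assert (H3 : is_derive (B0 1) v (1 / 2 * B1 1 v)) by (apply is_derive_B0; lra).
  assert (H4 : is_derive (fun v => v * B1 1 v) v (/ 2 * B0 1 v)) by (apply is_derive_id_B1; lra).
  replace (W / 2 * (B1 (-1) (W - v) * B1 1 v)) with
    (plus (plus (mult (-1 * (/ 2 * B0 (-1) (W - v))) (B0 1 v))
                (mult ((W - v) * B1 (-1) (W - v)) (1 / 2 * B1 1 v)))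
          (plus (mult (-1 * (-1 / 2 * B1 (-1) (W - v))) (v * B1 1 v))
                (mult (B0 (-1) (W - v)) (/ 2 * B0 1 v)))).
  - apply (is_derive_plus
      (fun v => (W - v) * B1 (-1) (W - v) * B0 1 v)
      (fun v => B0 (-1) (W - v) * (v * B1 1 v))).
    + apply (is_derive_mult (fun v => (W - v) * B1 (-1) (W - v)) (B0 1)); auto.
      intros; apply Rmult_comm.
    + apply (is_derive_mult (fun v => B0 (-1) (W - v)) (fun v => v * B1 1 v)); auto.
      intros; apply Rmult_comm.
  - unfold plus, mult; simpl. field.
Qed.

Lemma B0_0 (s : R) : B0 s 0 = 1.
Proof. unfold B0. rewrite PSeries_0. unfold bes0. simpl. field. Qed.

(** * The backstepping kernels *)

Lemma Kk_continuity_2d (eps lam x y : R) : eps <> 0 -> continuity_2d_pt (Kk eps lam) x y.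
Proof.
  intros He. unfold Kk.
  apply continuity_2d_pt_mult.
  - apply continuity_2d_pt_mult; [apply continuity_2d_pt_const|apply continuity_2d_pt_id1].
  - apply (continuity_1d_2d_pt_comp I1sq (fun x y => lam * (x ^ 2 - y ^ 2) / eps)).
    + apply continuity_pt_filterlim.
      apply (cont_ext (B1 1)); [intros; now rewrite I1sq_B1|].
      apply B1_continuous; lra.
    + apply continuity_2d_pt_ext with (fun x y => (lam / eps) * (x * x - y * y)).
      { intros; field; auto. }
      apply continuity_2d_pt_mult; [apply continuity_2d_pt_const|].
      apply continuity_2d_pt_minus; apply continuity_2d_pt_mult;
        (apply continuity_2d_pt_id1 || apply continuity_2d_pt_id2).
Qed.

Lemma Lk_continuity_2d (eps lam x y : R) : eps <> 0 -> continuity_2d_pt (Lk eps lam) x y.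
Proof.
  intros He. unfold Lk.
  apply continuity_2d_pt_mult.
  - apply continuity_2d_pt_mult; [apply continuity_2d_pt_const|apply continuity_2d_pt_id1].
  - apply (continuity_1d_2d_pt_comp J1sq (fun x y => lam * (x ^ 2 - y ^ 2) / eps)).
    + apply continuity_pt_filterlim.
      apply (cont_ext (B1 (-1))); [intros; now rewrite J1sq_B1|].
      apply B1_continuous; lra.
    + apply continuity_2d_pt_ext with (fun x y => (lam / eps) * (x * x - y * y)).
      { intros; field; auto. }
      apply continuity_2d_pt_mult; [apply continuity_2d_pt_const|].
      apply continuity_2d_pt_minus; apply continuity_2d_pt_mult;
        (apply continuity_2d_pt_id1 || apply continuity_2d_pt_id2).
Qed.

(* Substituting [v = lam / eps * (y ^ 2 - s ^ 2)] turns the composition of the kernels into the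
   convolution of [J1sq] and [I1sq]. *)
Lemma Lk_Kk_compose (eps lam s x : R) : 0 < eps -> 0 < lam -> 0 <= s <= x ->
  RInt (fun y => Lk eps lam x y * Kk eps lam y s) s x = Lk eps lam x s - Kk eps lam x s.
Proof.
  intros He Hl [Hs Hsx].
  (* The antiderivative used below divides by [W], which is zero here. On the diagonal both kernels
     equal [- lam / (2 eps) * x], so both sides vanish. *)
  destruct (Req_dec s x) as [->|Hne].
  { rewrite RInt_point. unfold Lk, Kk. rewrite I1sq_B1, J1sq_B1.
    replace (lam * (x ^ 2 - x ^ 2) / eps) with 0 by (field; lra).
    unfold B1. rewrite !PSeries_0. unfold bes1, zero; simpl. field; lra. }
  set (c := lam / eps). assert (Hc : 0 < c) by (apply Rdiv_lt_0_compat; lra).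
  set (W := c * (x ^ 2 - s ^ 2)).
  assert (HW : 0 < W) by (apply Rmult_lt_0_compat; nra).
  set (F := fun v => (W - v) * B1 (-1) (W - v) * B0 1 v + B0 (-1) (W - v) * (v * B1 1 v)).
  assert (HE : forall y, Lk eps lam x y * Kk eps lam y s =
      c * x / W * ((c * (2 * y)) * (W / 2 * (B1 (-1) (W - c * (y ^ 2 - s ^ 2))
                            * B1 1 (c * (y ^ 2 - s ^ 2)))))).
  { intros y. unfold Lk, Kk. rewrite I1sq_B1, J1sq_B1.
    replace (lam * (x ^ 2 - y ^ 2) / eps) with (W - c * (y ^ 2 - s ^ 2))
      by (unfold W, c; field; lra).
    replace (lam * (y ^ 2 - s ^ 2) / eps) with (c * (y ^ 2 - s ^ 2)) by (unfold c; field; lra).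
    fold c. field. lra. }
  assert (HD : forall y, is_derive (fun y => c * x / W * F (c * (y ^ 2 - s ^ 2))) y
                           (Lk eps lam x y * Kk eps lam y s)).
  { intros y. rewrite HE. apply is_derive_scal.
    apply (is_derive_comp F (fun y => c * (y ^ 2 - s ^ 2))).
    - apply bessel_convolution_derive.
    - auto_derive; [auto|ring]. }
  apply is_RInt_unique.
  replace (Lk eps lam x s - Kk eps lam x s) with
    (minus (c * x / W * F (c * (x ^ 2 - s ^ 2))) (c * x / W * F (c * (s ^ 2 - s ^ 2)))).
  - apply (is_RInt_derive (fun y => c * x / W * F (c * (y ^ 2 - s ^ 2)))).
    + intros y _. apply HD.
    + intros y _. apply (cont_Rmult (fun y => Lk eps lam x y) (fun y => Kk eps lam y s)).
      * apply continuity_2d_snd, Lk_continuity_2d. lra.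
      * apply (continuity_2d_fst (Kk eps lam)), Kk_continuity_2d. lra.
  - change (c * x / W * F W - c * x / W * F (c * (s ^ 2 - s ^ 2)) = Lk eps lam x s - Kk eps lam x s).
    replace (c * (s ^ 2 - s ^ 2)) with 0 by ring. unfold F.
    replace (W - W) with 0 by ring.
    rewrite Rminus_0_r, !B0_0. unfold Lk, Kk. rewrite I1sq_B1, J1sq_B1.
    replace (lam * (x ^ 2 - s ^ 2) / eps) with W by (unfold W, c; field; lra).
    fold c. field. lra.
Qed.

(** * Integrals depending on a parameter *)

Lemma continuous_RInt_param (h : R -> R -> R) (a b c : R) : a <= b ->
  (forall x, a <= x <= b -> continuity_2d_pt h c x) ->
  (forall v, ex_RInt (h v) a b) -> continuous (fun v => RInt (h v) a b) c.
Proof.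
  intros Hab Hc Hi. apply filterlim_locally. intros e.
  (* The [+ 1] keeps the quotient meaningful for [a = b] and makes the final inequality strict. *)
  assert (He : 0 < e / (b - a + 1)) by (apply Rdiv_lt_0_compat; [apply cond_pos|lra]).
  destruct (uniform_continuity_2d_1d' h a b c Hc (mkposreal _ He)) as [d Hd].
  exists d. intros v Hv. change (Rabs (RInt (h v) a b - RInt (h c) a b) < e).
  rewrite <- RInt_Rminus by auto.
  apply Rle_lt_trans with ((b - a) * (e / (b - a + 1))).
  - apply abs_RInt_le_const; auto.
    + apply (@ex_RInt_minus R_CompleteNormedModule); auto.
    + intros t Ht. apply Rlt_le, (Hd t c t v); auto.
      * pose proof (cond_pos d); lra.
      * change (Rabs (v - c) < d) in Hv. apply Rabs_def2 in Hv. lra.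
      * rewrite Rminus_eq_0, Rabs_R0. apply cond_pos.
  - replace (e : R) with ((b - a + 1) * (e / (b - a + 1))) at 2 by (field; lra).
    apply Rmult_lt_compat_r; lra.
Qed.

Lemma continuity_2d_comp (h f g : R -> R -> R) (x y : R) :
  continuity_2d_pt h (f x y) (g x y) -> continuity_2d_pt f x y -> continuity_2d_pt g x y ->
  continuity_2d_pt (fun u v => h (f u v) (g u v)) x y.
Proof.
  intros Hh Hf Hg e. destruct (Hh e) as [d Hd].
  destruct (Hf d) as [d1 H1]. destruct (Hg d) as [d2 H2].
  assert (Hm : 0 < Rmin d1 d2) by (apply Rmin_glb_lt; apply cond_pos).
  exists (mkposreal _ Hm). simpl. intros u v Hu Hv.
  pose proof (Rmin_l d1 d2). pose proof (Rmin_r d1 d2).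
  apply Hd; [apply H1|apply H2]; lra.
Qed.

Lemma continuity_2d_of_snd (f : R -> R) (x y : R) : continuous f y ->
  continuity_2d_pt (fun _ v => f v) x y.
Proof.
  intros H. apply (continuity_1d_2d_pt_comp f (fun _ v => v)).
  - now apply continuity_pt_filterlim.
  - apply continuity_2d_pt_id2.
Qed.

(** The substitution [y = v s] fixes the limits at [0] and [1], whatever the sign of [v], and moves
    the whole dependence on [v] into the integrand. *)
Lemma continuous_RInt_upper_param (h : R -> R -> R) (c : R) :
  (forall x y, continuity_2d_pt h x y) -> continuous (fun v => RInt (h v) 0 v) c.
Proof.
  intros Hh.
  apply cont_ext with (fun v => RInt (fun s => v * h v (v * s)) 0 1).
  - intros v.
    assert (E : RInt (fun s => v * h v (v * s + 0)) 0 1 = RInt (h v) (v * 0 + 0) (v * 1 + 0)).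
    { apply (RInt_comp_lin (h v) v 0 0 1), ex_RInt_cont. intros x. now apply continuity_2d_snd. }
    rewrite Rmult_0_r, Rmult_1_r, !Rplus_0_r in E. rewrite <- E.
    apply RInt_ext. intros s _. now rewrite Rplus_0_r.
  - assert (H2 : forall x y, continuity_2d_pt (fun v s => v * h v (v * s)) x y).
    { intros x y. apply continuity_2d_pt_mult; [apply continuity_2d_pt_id1|].
      apply (continuity_2d_comp h (fun v _ => v) (fun v s => v * s)); [apply Hh| |].
      - apply continuity_2d_pt_id1.
      - apply continuity_2d_pt_mult; [apply continuity_2d_pt_id1|apply continuity_2d_pt_id2]. }
    apply (continuous_RInt_param (fun v s => v * h v (v * s))); [lra|auto|].
    intros v. apply ex_RInt_cont. intros x.
    now apply (continuity_2d_snd (fun v s => v * h v (v * s))).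
Qed.

(** Fubini on a triangle by the fundamental theorem: as a function of [x], the right-hand side
    vanishes at [0] and its derivative is the outer integrand of the left-hand side. *)
Lemma RInt_triangle_swap (g : R -> R -> R) (f : R -> R) (x : R) :
  (forall u v, continuity_2d_pt g u v) -> (forall s, continuous f s) ->
  RInt (fun y => RInt (fun s => g y s * f s) 0 y) 0 x
    = RInt (fun s => RInt (fun y => g y s) s x * f s) 0 x.
Proof.
  intros Hg Hf.
  assert (Hgf : forall u v, continuity_2d_pt (fun y s => g y s * f s) u v).
  { intros u v. apply continuity_2d_pt_mult; [apply Hg|]. now apply continuity_2d_of_snd. }
  assert (HI : forall s y, is_derive (fun z => RInt (fun y => g y s) s z * f s) y (g y s * f s)).
  { intros s y. apply is_derive_ext with (fun z => f s * RInt (fun y => g y s) s z).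
    - intros t. apply Rmult_comm.
    - rewrite Rmult_comm. apply is_derive_scal.
      apply (is_derive_RInt (fun y => g y s) _ s).
      + exists (mkposreal 1 Rlt_0_1). intros b _.
        apply (@RInt_correct R_CompleteNormedModule), ex_RInt_cont.
        intros z. apply (continuity_2d_fst g), Hg.
      + apply (continuity_2d_fst g), Hg. }
  assert (HC : forall z, continuous (fun s => RInt (fun y => g y s) s z) z /\
                 forall s, continuous (fun s => RInt (fun y => g y s) s z * f s) s).
  { intros z.
    assert (Hs : forall s, continuous (fun s => RInt (fun y => g y s) s z) s).
    { intros s0.
      apply cont_ext with (fun s => RInt (fun y => g y s) 0 z - RInt (fun y => g y s) 0 s).
      - intros s. rewrite <- (RInt_Chasles (fun y => g y s) 0 s z).
        + unfold plus; simpl. ring.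
        + apply ex_RInt_cont. intros y. apply (continuity_2d_fst g), Hg.
        + apply ex_RInt_cont. intros y. apply (continuity_2d_fst g), Hg.
      - assert (Hsw : forall u v, continuity_2d_pt (fun s y => g y s) u v).
        { intros u v. apply (continuity_2d_comp g (fun _ y => y) (fun s _ => s)); [apply Hg| |].
          - apply continuity_2d_pt_id2.
          - apply continuity_2d_pt_id1. }
        apply cont_Rminus.
        + destruct (Rle_dec 0 z) as [Hz|Hz].
          * apply (continuous_RInt_param (fun s y => g y s)); auto.
            intros v. apply ex_RInt_cont. intros y. apply (continuity_2d_fst g), Hg.
          * apply cont_ext with (fun s => 0 - RInt (fun y => g y s) z 0).
            { intros s. rewrite <- (opp_RInt_swap (fun y => g y s)).
              - unfold opp; simpl; ring.
              - apply ex_RInt_cont. intros y. apply (continuity_2d_fst g), Hg. }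
            apply cont_Rminus; [apply continuous_const|].
            apply (continuous_RInt_param (fun s y => g y s)); [lra|auto|].
            intros v. apply ex_RInt_cont. intros y. apply (continuity_2d_fst g), Hg.
        + apply (continuous_RInt_upper_param (fun s y => g y s)). exact Hsw. }
    split; [apply Hs|]. intros s. apply cont_Rmult; auto. }
  set (E := fun z => RInt (fun s => RInt (fun y => g y s) s z * f s) 0 z : R).
  assert (HE : forall z, is_derive E z (RInt (fun s => g z s * f s) 0 z)).
  { intros z.
    assert (HD : forall u v,
       Derive (fun z => RInt (fun y => g y v) v z * f v) u = g u v * f v).
    { intros u v. apply is_derive_unique, HI. }
    assert (HDc : forall u v, continuity_2d_pt
       (fun u v => Derive (fun z => RInt (fun y => g y v) v z * f v) u) u v).
    { intros u v. apply continuity_2d_pt_ext with (fun u v => g u v * f v); [|apply Hgf].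
      intros; now rewrite HD. }
    (* Leibniz rule: the moving upper limit contributes the inner integral at [s = z], taken over
       the empty interval from [z] to [z]. *)
    replace (RInt (fun s => g z s * f s) 0 z) with
      (RInt (fun s => Derive (fun z => RInt (fun y => g y s) s z * f s) z) 0 z
         + (RInt (fun y => g y z) z z * f z) * 1).
    - apply (is_derive_RInt_param_bound_comp_aux3
        (fun z s => RInt (fun y => g y s) s z * f s) 0 (fun z => z) z 1).
      + exists (mkposreal 1 Rlt_0_1). intros u _. apply ex_RInt_cont, HC.
      + exists (mkposreal 1 Rlt_0_1), (mkposreal 1 Rlt_0_1). intros u _.
        apply ex_RInt_cont, HC.
      + apply (@is_derive_id R_AbsRing).
      + exists (mkposreal 1 Rlt_0_1), (mkposreal 1 Rlt_0_1). intros u _ t _.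
        eexists. apply HI.
      + intros t _. apply HDc.
      + exists (mkposreal 1 Rlt_0_1). intros u v _ _. apply HDc.
      + apply continuity_pt_filterlim, HC.
    - rewrite RInt_point. rewrite (RInt_ext _ (fun s => g z s * f s)) by (intros; apply HD).
      unfold zero; simpl. ring. }
  apply is_RInt_unique.
  replace (RInt _ 0 x) with (minus (E x) (E 0)).
  - apply (is_RInt_derive E).
    + intros y _. apply HE.
    + intros y _. apply (continuous_RInt_upper_param (fun y s => g y s * f s)). exact Hgf.
  - unfold E at 2. rewrite RInt_point. unfold minus, plus, opp, zero; simpl. unfold E. ring.
Qed.

(** A profile extended by constants may have corners at [0] and [1], so the derivative is asked for
    inside only. There [F - RInt g a] has derivative zero, and continuity carries the conclusion to
    the ends. *)
Lemma RInt_interior_derive (F g : R -> R) (a b : R) : a <= b ->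
  (forall x, a < x < b -> is_derive F x (g x)) ->
  (forall x, continuous F x) -> (forall x, continuous g x) -> RInt g a b = F b - F a.
Proof.
  intros Hab HF HFc Hg.
  assert (HI : forall x, is_derive (RInt g a) x (g x)).
  { intros x. apply (is_derive_RInt g _ a); [|apply Hg].
    exists (mkposreal 1 Rlt_0_1). intros y _.
    apply (@RInt_correct R_CompleteNormedModule), ex_RInt_cont, Hg. }
  destruct (MVT_gen (fun x => F x - RInt g a x) a b (fun _ => 0)) as [c [_ Hc]].
  - rewrite Rmin_left, Rmax_right by exact Hab. intros x Hx.
    replace 0 with (minus (g x) (g x)) by (unfold minus, plus, opp; simpl; ring).
    apply (is_derive_minus F (RInt g a)); auto.
  - intros x _. apply continuity_pt_filterlim. apply (cont_Rminus F (RInt g a)); auto.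
    eapply is_derive_continuous; apply HI.
  - rewrite RInt_point in Hc. unfold zero in Hc; simpl in Hc. lra.
Qed.

(** * The inverse backstepping transformation *)

Definition transK (eps lam : R) (f : R -> R) (x : R) : R :=
  f x - RInt (fun y => Kk eps lam x y * f y) 0 x.

Lemma transK_continuous (eps lam : R) (f : R -> R) (x : R) : eps <> 0 ->
  (forall y, continuous f y) -> continuous (transK eps lam f) x.
Proof.
  intros He Hf. apply cont_Rminus; [apply Hf|].
  apply (continuous_RInt_upper_param (fun x y => Kk eps lam x y * f y)).
  intros u v. apply continuity_2d_pt_mult.
  - now apply Kk_continuity_2d.
  - now apply continuity_2d_of_snd.
Qed.

(** In operator form: [L K = L - K] amounts to [(1 + L) (1 - K) = 1]. *)
Lemma transK_inverse (eps lam : R) (f : R -> R) (x : R) : 0 < eps -> 0 < lam -> 0 <= x ->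
  (forall y, continuous f y) ->
  f x = transK eps lam f x + RInt (fun y => Lk eps lam x y * transK eps lam f y) 0 x.
Proof.
  intros He Hl Hx Hf.
  assert (HL : forall y, continuous (fun y => Lk eps lam x y) y).
  { intros y. apply continuity_2d_snd, Lk_continuity_2d. lra. }
  assert (HK : forall u v, continuity_2d_pt (fun y s => Kk eps lam y s * f s) u v).
  { intros u v. apply continuity_2d_pt_mult; [apply Kk_continuity_2d; lra|].
    now apply continuity_2d_of_snd. }
  assert (HKx : forall y, continuous (fun y => Kk eps lam x y * f y) y).
  { intros y. now apply (continuity_2d_snd (fun x y => Kk eps lam x y * f y)). }
  assert (HLK : forall u v, continuity_2d_pt (fun y s => Lk eps lam x y * Kk eps lam y s) u v).
  { intros u v. apply continuity_2d_pt_mult; [|apply Kk_continuity_2d; lra].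
    apply (continuity_1d_2d_pt_comp (Lk eps lam x) (fun u _ => u)).
    - apply continuity_pt_filterlim, HL.
    - apply continuity_2d_pt_id1. }
  rewrite (RInt_ext _ (fun y => Lk eps lam x y * f y
      - RInt (fun s => Lk eps lam x y * Kk eps lam y s * f s) 0 y)).
  2:{ intros y _. unfold transK. rewrite Rmult_minus_distr_l. f_equal.
      rewrite <- RInt_Rscal.
      - apply RInt_ext. intros s _. symmetry. apply Rmult_assoc.
      - apply ex_RInt_cont. intros s. now apply (continuity_2d_snd (fun y s => Kk eps lam y s * f s)). }
  rewrite RInt_Rminus.
  2:{ apply ex_RInt_cont. intros y. apply cont_Rmult; auto. }
  2:{ apply ex_RInt_cont. intros y.
      apply (continuous_RInt_upper_param (fun y s => Lk eps lam x y * Kk eps lam y s * f s)).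
      intros u v. apply continuity_2d_pt_mult; auto. now apply continuity_2d_of_snd. }
  rewrite (RInt_triangle_swap (fun y s => Lk eps lam x y * Kk eps lam y s)); auto.
  rewrite (RInt_Rext (fun s => RInt _ s x * f s)
             (fun s => Lk eps lam x s * f s - Kk eps lam x s * f s)); [|intros s Hs|exact Hx].
  2:{ rewrite Lk_Kk_compose; auto. ring. }
  rewrite RInt_Rminus.
  2:{ apply ex_RInt_cont. intros y. apply cont_Rmult; auto. }
  2:{ now apply ex_RInt_cont. }
  unfold transK. ring.
Qed.

(** The integral under the root is the squared Hilbert-Schmidt norm of [L]. With [f = w + v] and
    [v = L w], the square of the norm is expanded; the cross term and the norm of [v] are both
    controlled by Cauchy-Schwarz. *)
Lemma sqnorm01_transK_bound (eps lam : R) (f : R -> R) : 0 < eps -> 0 < lam ->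
  (forall y, continuous f y) ->
  sqnorm01 f <=
    (1 + sqrt (RInt (fun x => RInt (fun y => (Lk eps lam x y) ^ 2) 0 x) 0 1)) ^ 2
      * sqnorm01 (transK eps lam f).
Proof.
  intros He Hl Hf.
  set (w := transK eps lam f). set (N := RInt _ 0 1 : R).
  assert (Hw : forall y, continuous w y) by (intros; apply transK_continuous; auto; lra).
  set (v := fun x => RInt (fun y => Lk eps lam x y * w y) 0 x : R).
  assert (HLw : forall x y, continuity_2d_pt (fun x y => Lk eps lam x y * w y) x y).
  { intros x y. apply continuity_2d_pt_mult; [apply Lk_continuity_2d; lra|].
    now apply continuity_2d_of_snd. }
  assert (Hv : forall x, continuous v x).
  { intros x. now apply (continuous_RInt_upper_param (fun x y => Lk eps lam x y * w y)). }
  assert (HL2 : forall x y, continuity_2d_pt (fun x y => (Lk eps lam x y) ^ 2) x y).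
  { intros x y. apply continuity_2d_pt_ext with (fun x y => Lk eps lam x y * Lk eps lam x y).
    - intros; ring.
    - apply continuity_2d_pt_mult; apply Lk_continuity_2d; lra. }
  set (l := fun x => RInt (fun y => (Lk eps lam x y) ^ 2) 0 x : R) in *.
  assert (Hlc : forall x, continuous l x).
  { intros x. now apply (continuous_RInt_upper_param (fun x y => (Lk eps lam x y) ^ 2)). }
  set (Wn := sqnorm01 w).
  assert (HWn : 0 <= Wn).
  { apply RInt_ge_0; [lra| |intros; apply pow2_ge_0].
    apply ex_RInt_cont. intros; now apply cont_pow2. }
  assert (Hl0 : forall x, 0 <= x -> 0 <= l x).
  { intros x Hx. unfold l. apply RInt_ge_0; [exact Hx| |intros; apply pow2_ge_0].
    apply ex_RInt_cont. intros y. now apply (continuity_2d_snd (fun x y => (Lk eps lam x y) ^ 2)). }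
  assert (Hvx : forall x, 0 <= x <= 1 -> (v x) ^ 2 <= Wn * l x).
  { intros x Hx. apply Rle_trans with (l x * RInt (fun y => (w y) ^ 2) 0 x).
    - apply (RInt_cauchy_schwarz (Lk eps lam x) w 0 x); [lra| |exact Hw].
      intros y. apply continuity_2d_snd, Lk_continuity_2d. lra.
    - rewrite Rmult_comm. apply Rmult_le_compat_r; [apply Hl0; lra|].
      unfold Wn, sqnorm01. rewrite <- (RInt_Chasles (fun y => (w y) ^ 2) 0 x 1).
      + assert (0 <= RInt (fun y => (w y) ^ 2) x 1).
        { apply RInt_ge_0; [lra| |intros; apply pow2_ge_0].
          apply ex_RInt_cont. intros; now apply cont_pow2. }
        unfold plus; simpl in *. lra.
      + apply ex_RInt_cont. intros; now apply cont_pow2.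
      + apply ex_RInt_cont. intros; now apply cont_pow2. }
  assert (HN : 0 <= N).
  { apply RInt_ge_0; [lra|now apply ex_RInt_cont|]. intros; apply Hl0; lra. }
  set (V := RInt (fun x => (v x) ^ 2) 0 1 : R).
  assert (HV : V <= Wn * N).
  { unfold V, N. rewrite <- RInt_Rscal by now apply ex_RInt_cont.
    apply RInt_le; [lra| | |].
    - apply ex_RInt_cont. intros; now apply cont_pow2.
    - apply ex_RInt_Rscal. now apply ex_RInt_cont.
    - intros; apply Hvx; lra. }
  assert (HV0 : 0 <= V).
  { apply RInt_ge_0; [lra| |intros; apply pow2_ge_0].
    apply ex_RInt_cont. intros; now apply cont_pow2. }
  set (C := RInt (fun x => w x * v x) 0 1 : R).
  assert (HC : C ^ 2 <= Wn * V).
  { now apply (RInt_cauchy_schwarz w v 0 1); [lra| |]. }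
  assert (HS : sqnorm01 f = Wn + (2 * C + V)).
  { unfold sqnorm01. rewrite (RInt_Rext _ (fun x => (w x) ^ 2 + (2 * (w x * v x) + (v x) ^ 2))).
    - rewrite RInt_Rplus, RInt_Rplus, RInt_Rscal; auto.
      + apply ex_RInt_cont; intros; now apply cont_Rmult.
      + apply ex_RInt_Rscal, ex_RInt_cont; intros; now apply cont_Rmult.
      + apply ex_RInt_cont; intros; now apply cont_pow2.
      + apply ex_RInt_cont; intros; now apply cont_pow2.
      + apply ex_RInt_Rplus.
        * apply ex_RInt_Rscal, ex_RInt_cont; intros; now apply cont_Rmult.
        * apply ex_RInt_cont; intros; now apply cont_pow2.
    - intros x Hx. rewrite (transK_inverse eps lam f x) by (auto; lra).
      fold w. fold (v x). ring.
    - lra. }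
  assert (HCs : C <= Wn * sqrt N).
  { apply Rle_trans with (Rabs C); [apply Rle_abs|].
    rewrite <- (Rabs_pos_eq (Wn * sqrt N)).
    - apply Rsqr_le_abs_0. unfold Rsqr.
      replace (Wn * sqrt N * (Wn * sqrt N)) with (Wn * (Wn * (sqrt N * sqrt N))) by ring.
      rewrite sqrt_sqrt by exact HN.
      apply Rle_trans with (Wn * V); [lra|]. now apply Rmult_le_compat_l.
    - apply Rmult_le_pos; [exact HWn|apply sqrt_pos]. }
  rewrite HS.
  replace ((1 + sqrt N) ^ 2 * Wn) with (Wn + 2 * (Wn * sqrt N) + Wn * (sqrt N * sqrt N)) by ring.
  rewrite sqrt_sqrt by exact HN. lra.
Qed.

(** The factor 2 from [(w + v)^2 <= 2 w^2 + 2 v^2] doubles the weight 3 of the boundary term of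
    [d']; hence the 6 in [alpha2] and in the second part of [alpha1]. *)
Lemma transK_boundary_bound (eps lam : R) (f : R -> R) : 0 < eps -> 0 < lam ->
  (forall y, continuous f y) ->
  (f 1) ^ 2 <= 2 * (transK eps lam f 1) ^ 2
    + 2 * (RInt (fun y => (Lk eps lam 1 y) ^ 2) 0 1 * sqnorm01 (transK eps lam f)).
Proof.
  intros He Hl Hf.
  assert (Hw : forall y, continuous (transK eps lam f) y)
    by (intros; apply transK_continuous; auto; lra).
  assert (HL : forall y, continuous (fun y => Lk eps lam 1 y) y).
  { intros y. apply continuity_2d_snd, Lk_continuity_2d. lra. }
  pose proof (RInt_cauchy_schwarz (Lk eps lam 1) (transK eps lam f) 0 1) as HCS.
  rewrite (transK_inverse eps lam f 1) by (auto; lra).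
  set (v := RInt (fun y => Lk eps lam 1 y * transK eps lam f y) 0 1 : R) in *.
  assert (v ^ 2 <= RInt (fun y => (Lk eps lam 1 y) ^ 2) 0 1 * sqnorm01 (transK eps lam f)).
  { now apply HCS; [lra| |]. }
  set (w := transK eps lam f 1).
  assert (0 <= (w - v) ^ 2) by apply pow2_ge_0.
  nra.
Qed.

(** * The control gain *)

(** The gain depends on [y] only through the entire series at [c (1 - y^2)]. Every derivative is
    thus explicit, and the first one carries a factor [y], whence its zero at [0]. *)
Lemma kg_smooth (eps lam q : R) : 0 < eps -> exists k1 k2 : R -> R,
  (forall y, is_derive (kg eps lam q) y (k1 y)) /\ (forall y, is_derive k1 y (k2 y)) /\
  (forall y, continuous k2 y) /\ k1 0 = 0.
Proof.
  intros He. set (c := lam / eps).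
  set (a1 := PS_derive (bes1 1)). set (a2 := PS_derive a1). set (a3 := PS_derive a2).
  assert (R0 : CV_radius (bes1 1) = p_infty) by (apply bes1_radius; lra).
  assert (R1 : CV_radius a1 = p_infty) by (unfold a1; now rewrite CV_radius_derive).
  assert (R2 : CV_radius a2 = p_infty) by (unfold a2; now rewrite CV_radius_derive).
  assert (R3 : CV_radius a3 = p_infty) by (unfold a3; now rewrite CV_radius_derive).
  pose proof (fun w => PSeries_entire_derive _ w R0) as D0.
  pose proof (fun w => PSeries_entire_derive _ w R1) as D1.
  pose proof (fun w => PSeries_entire_derive _ w R2) as D2.
  fold a1 in D0. fold a2 in D1. fold a3 in D2.
  (* [A] collects [r K (1, y)] and the derivative of the outer factor [x] of [K]; [B] comes from the
     chain rule, the derivative of [c (x^2 - y^2)] at [x = 1] being [2 c]. *)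
  set (A := - c * (rr eps lam q + 1)). set (B := - 2 * c ^ 2).
  assert (Hv : forall y, is_derive (fun y => c * (1 - y ^ 2)) y (c * (- 2 * y)))
    by (intros; auto_derive; [auto|ring]).
  assert (Hcomp : forall P P' y, (forall w, is_derive P w (P' w)) ->
    is_derive (fun y => P (c * (1 - y ^ 2))) y (c * (- 2 * y) * P' (c * (1 - y ^ 2)))).
  { intros P P' y H. apply (is_derive_comp P); [apply H|apply Hv]. }
  assert (Hk : forall y, kg eps lam q y
     = A * PSeries (bes1 1) (c * (1 - y ^ 2)) + B * PSeries a1 (c * (1 - y ^ 2))).
  { intros y. unfold kg.
    assert (HD : is_derive (fun x => Kk eps lam x y) 1
      (- c * PSeries (bes1 1) (c * (1 - y ^ 2)) + - c * (2 * c * PSeries a1 (c * (1 - y ^ 2))))).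
    { apply is_derive_ext with (fun x => - c * x * PSeries (bes1 1) (c * (x ^ 2 - y ^ 2))).
      - intros x. unfold Kk. rewrite I1sq_B1. unfold B1.
        replace (lam * (x ^ 2 - y ^ 2) / eps) with (c * (x ^ 2 - y ^ 2)) by (unfold c; field; lra).
        reflexivity.
      - replace (_ + _) with (plus (mult (- c) (PSeries (bes1 1) (c * (1 ^ 2 - y ^ 2))))
            (mult (- c * 1) (2 * c * PSeries a1 (c * (1 ^ 2 - y ^ 2)))))
          by (unfold plus, mult; simpl; rewrite !Rmult_1_l, !Rmult_1_r; reflexivity).
        apply (is_derive_mult (fun x => - c * x)
                 (fun x => PSeries (bes1 1) (c * (x ^ 2 - y ^ 2)))).
        + auto_derive; [auto|ring].
        + apply (is_derive_comp (PSeries (bes1 1)) (fun x => c * (x ^ 2 - y ^ 2))).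
          * apply D0.
          * auto_derive; [auto|ring].
        + intros; apply Rmult_comm. }
    assert (ED : Derive (fun x : R => Kk eps lam x y) 1 = _) by exact (is_derive_unique _ _ _ HD).
    rewrite ED. unfold Kk. rewrite I1sq_B1. unfold B1.
    replace (lam * (1 ^ 2 - y ^ 2) / eps) with (c * (1 - y ^ 2)) by (unfold c; field; lra).
    fold c. unfold A, B. ring. }
  exists (fun y => c * (- 2 * y) * (A * PSeries a1 (c * (1 - y ^ 2)) + B * PSeries a2 (c * (1 - y ^ 2)))).
  exists (fun y => c * (- 2) * (A * PSeries a1 (c * (1 - y ^ 2)) + B * PSeries a2 (c * (1 - y ^ 2)))
     + c * (- 2 * y) * (c * (- 2 * y) *
        (A * PSeries a2 (c * (1 - y ^ 2)) + B * PSeries a3 (c * (1 - y ^ 2))))).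
  split; [|split; [|split]].
  - intros y. apply is_derive_ext with (fun y =>
      A * PSeries (bes1 1) (c * (1 - y ^ 2)) + B * PSeries a1 (c * (1 - y ^ 2))).
    { intros; now rewrite Hk. }
    replace (_ * _) with (plus (A * (c * (- 2 * y) * PSeries a1 (c * (1 - y ^ 2))))
       (B * (c * (- 2 * y) * PSeries a2 (c * (1 - y ^ 2))))) by (unfold plus; simpl; ring).
    apply (is_derive_plus (fun y => A * PSeries (bes1 1) (c * (1 - y ^ 2)))
      (fun y => B * PSeries a1 (c * (1 - y ^ 2)))); apply is_derive_scal; now apply Hcomp.
  - intros y.
    apply (is_derive_mult (fun y => c * (- 2 * y))
      (fun y => A * PSeries a1 (c * (1 - y ^ 2)) + B * PSeries a2 (c * (1 - y ^ 2)))).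
    + auto_derive; [auto|ring].
    + replace (_ * _) with (plus (A * (c * (- 2 * y) * PSeries a2 (c * (1 - y ^ 2))))
         (B * (c * (- 2 * y) * PSeries a3 (c * (1 - y ^ 2))))) by (unfold plus; simpl; ring).
      apply (is_derive_plus (fun y => A * PSeries a1 (c * (1 - y ^ 2)))
        (fun y => B * PSeries a2 (c * (1 - y ^ 2)))); apply is_derive_scal; now apply Hcomp.
    + intros; apply Rmult_comm.
  - intros y.
    assert (Hcc : forall a, CV_radius a = p_infty ->
              continuous (fun y => PSeries a (c * (1 - y ^ 2))) y).
    { intros a Ha. eapply is_derive_continuous. apply Hcomp. intros w.
      now apply PSeries_entire_derive. }
    assert (Hl : continuous (fun y => c * (- 2 * y)) y).
    { eapply is_derive_continuous. instantiate (1 := c * -2). auto_derive; [auto|ring]. }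
    assert (Hab : forall a b, CV_radius a = p_infty -> CV_radius b = p_infty -> continuous
              (fun y => A * PSeries a (c * (1 - y ^ 2)) + B * PSeries b (c * (1 - y ^ 2))) y).
    { intros a b Ha Hb. apply cont_Rplus; (apply cont_Rmult; [apply continuous_const|]);
        now apply Hcc. }
    apply cont_Rplus; (apply cont_Rmult; [|try now apply Hab]).
    + apply continuous_const.
    + exact Hl.
    + apply cont_Rmult; [exact Hl|now apply Hab].
  - ring.
Qed.

(** * Regularity of the closed-loop state *)

(** Composition with [clamp] extends a profile on [[0, 1]] by its end values, so that continuity
    relative to the strip becomes continuity on the line. *)
Definition clamp (x : R) : R := Rmax 0 (Rmin 1 x).

Lemma clamp_range (x : R) : 0 <= clamp x <= 1.
Proof.
  unfold clamp. split; [apply Rmax_l|]. apply Rmax_lub; [lra|apply Rmin_l].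
Qed.

Lemma clamp_id (x : R) : 0 <= x <= 1 -> clamp x = x.
Proof. intros H. unfold clamp. rewrite Rmin_right, Rmax_right; lra. Qed.

Lemma Rmax_continuous (s t : R) : continuous (fun t => Rmax s t) t.
Proof.
  apply cont_ext with (fun t => (s + t + Rabs (s - t)) / 2).
  { intros y. unfold Rmax. destruct (Rle_dec s y).
    - rewrite Rabs_left1 by lra. lra.
    - rewrite Rabs_pos_eq by lra. lra. }
  apply (cont_Rmult (fun t => s + t + Rabs (s - t)) (fun _ => / 2)); [|apply continuous_const].
  apply (cont_Rplus (fun t => s + t)).
  - apply cont_Rplus; [apply continuous_const|apply continuous_id].
  - apply (continuous_comp (fun t => s - t) Rabs); [|apply continuous_Rabs].
    apply cont_Rminus; [apply continuous_const|apply continuous_id].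
Qed.

Lemma clamp_continuous (x : R) : continuous clamp x.
Proof.
  apply (continuous_comp (fun x => Rmin 1 x) (Rmax 0)); [|apply Rmax_continuous].
  apply cont_ext with (fun x => 0 - Rmax (-1) (0 - x)).
  { intros y. unfold Rmin, Rmax. destruct (Rle_dec (-1) (0 - y)), (Rle_dec 1 y); lra. }
  apply cont_Rminus; [apply continuous_const|].
  apply (continuous_comp (fun x => 0 - x) (Rmax (-1))); [|apply Rmax_continuous].
  apply cont_Rminus; [apply continuous_const|apply continuous_id].
Qed.

Lemma cont_on_comp (D : R * R -> Prop) (f a b : R -> R -> R) (u v : R) : cont_on D f ->
  locally_2d (fun u v => D (a u v, b u v)) u v ->
  continuity_2d_pt a u v -> continuity_2d_pt b u v ->
  continuity_2d_pt (fun u v => f (a u v) (b u v)) u v.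
Proof.
  intros Hf HD Ha Hb e.
  pose proof (locally_2d_singleton _ _ _ HD) as H0.
  destruct (proj1 (filterlim_locally _ _) (Hf _ H0) e) as [d Hd].
  destruct HD as [d0 H1]. destruct (Ha d) as [d1 H2]. destruct (Hb d) as [d2 H3].
  assert (Hm : 0 < Rmin d0 (Rmin d1 d2)) by (repeat apply Rmin_glb_lt; apply cond_pos).
  exists (mkposreal _ Hm). simpl. intros u' v' Hu Hv.
  pose proof (Rmin_l d0 (Rmin d1 d2)). pose proof (Rmin_r d0 (Rmin d1 d2)).
  pose proof (Rmin_l d1 d2). pose proof (Rmin_r d1 d2).
  apply (Hd (a u' v', b u' v')).
  - split; [apply H2|apply H3]; lra.
  - apply H1; lra.
Qed.

Lemma continuity_2d_clamp (u v : R) : continuity_2d_pt (fun _ x => clamp x) u v.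
Proof. apply continuity_2d_of_snd, clamp_continuous. Qed.

Lemma cont_on_strip_open (s : R) (f : R -> R -> R) (t x : R) : cont_on (strip_open s) f -> s < t ->
  continuity_2d_pt (fun t x => f (clamp x) t) t x.
Proof.
  intros Hf Ht. apply (cont_on_comp (strip_open s) f (fun _ x => clamp x) (fun t _ => t)).
  - exact Hf.
  - assert (Hp : 0 < t - s) by lra. exists (mkposreal _ Hp). simpl. intros u v Hu _.
    split; [apply clamp_range|]. apply Rabs_def2 in Hu. simpl. lra.
  - apply continuity_2d_clamp.
  - apply continuity_2d_pt_id1.
Qed.

(** [Rmax s] freezes time before [s], which makes the one-sided continuity at the event two-sided.
    The limit of [dev] at the event rests on this. *)
Lemma cont_on_strip_closed (s : R) (f : R -> R -> R) (t x : R) : cont_on (strip_closed s) f ->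
  continuity_2d_pt (fun t x => f (clamp x) (Rmax s t)) t x.
Proof.
  intros Hf.
  apply (cont_on_comp (strip_closed s) f (fun _ x => clamp x) (fun t _ => Rmax s t)).
  - exact Hf.
  - exists (mkposreal 1 Rlt_0_1). intros u v _ _. split; [apply clamp_range|apply Rmax_l].
  - apply continuity_2d_clamp.
  - apply (continuity_1d_2d_pt_comp (Rmax s) (fun t _ => t)).
    + apply continuity_pt_filterlim, Rmax_continuous.
    + apply continuity_2d_pt_id1.
Qed.

Lemma cont_on_strip_closed_slice (s : R) (f : R -> R -> R) (t x : R) :
  cont_on (strip_closed s) f -> s <= t -> continuous (fun x => f (clamp x) t) x.
Proof.
  intros Hf Ht.
  pose proof (continuity_2d_snd _ t x (cont_on_strip_closed s f t x Hf)) as H.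
  simpl in H. now rewrite Rmax_right in H.
Qed.

Lemma cont_on_strip_open_slice (s : R) (f : R -> R -> R) (t x : R) :
  cont_on (strip_open s) f -> s < t -> continuous (fun x => f (clamp x) t) x.
Proof.
  intros Hf Ht. exact (continuity_2d_snd _ t x (cont_on_strip_open s f t x Hf Ht)).
Qed.

Lemma deriv01_clamp (f : R -> R) (x l : R) : 0 < x < 1 -> deriv01 f x l ->
  is_derive (fun x => f (clamp x)) x l.
Proof.
  intros Hx Hf.
  assert (Hm : 0 < Rmin x (1 - x)) by (apply Rmin_glb_lt; lra).
  pose proof (Rmin_l x (1 - x)). pose proof (Rmin_r x (1 - x)).
  apply is_derive_ext_loc with f.
  { exists (mkposreal _ Hm). intros y Hy. change (Rabs (y - x) < Rmin x (1 - x)) in Hy.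
    apply Rabs_def2 in Hy. rewrite clamp_id; [reflexivity|lra]. }
  apply is_derive_Reals. intros e He.
  destruct (proj1 (filterlim_locally _ _) Hf (mkposreal e He)) as [d Hd].
  assert (Hm' : 0 < Rmin d (Rmin x (1 - x))) by (apply Rmin_glb_lt; [apply cond_pos|exact Hm]).
  exists (mkposreal _ Hm'). simpl. intros h Hh Hh2.
  pose proof (Rmin_l d (Rmin x (1 - x))). pose proof (Rmin_r d (Rmin x (1 - x))).
  apply (Hd h).
  - change (Rabs (h - 0) < d). rewrite Rminus_0_r. lra.
  - split; [exact Hh|]. assert (Hh3 : Rabs h < Rmin x (1 - x)) by lra.
    apply Rabs_def2 in Hh3. lra.
Qed.

(** * The deviation and its derivative *)

Lemma dev_ex_RInt (k : R -> R) (f g : R -> R) : (forall y, continuous k y) ->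
  (forall y, continuous f y) -> (forall y, continuous g y) ->
  ex_RInt (fun y => k y * (f y - g y)) 0 1.
Proof. intros. apply ex_RInt_cont. intros y. apply cont_Rmult; auto. now apply cont_Rminus. Qed.

Lemma kg_continuous (eps lam q y : R) : 0 < eps -> continuous (kg eps lam q) y.
Proof.
  intros He. destruct (kg_smooth eps lam q He) as (k1 & k2 & H & _).
  eapply is_derive_continuous. apply H.
Qed.

Lemma dev_at_right (eps lam q s : R) (uh : R -> R -> R) : 0 < eps ->
  cont_on (strip_closed s) uh ->
  filterlim (dev eps lam q uh s) (at_right s) (locally 0).
Proof.
  intros He Huh.
  set (h := fun t y => kg eps lam q y * (uh (clamp y) s - uh (clamp y) (Rmax s t))).
  assert (Hh : forall t y, continuity_2d_pt h t y).
  { intros t y. apply continuity_2d_pt_mult.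
    - now apply continuity_2d_of_snd, kg_continuous.
    - apply continuity_2d_pt_minus.
      + apply (continuity_2d_of_snd (fun y => uh (clamp y) s)).
        apply (cont_on_strip_closed_slice s uh s); [exact Huh|lra].
      + now apply cont_on_strip_closed. }
  assert (Hc : continuous (fun t => RInt (h t) 0 1) s).
  { apply continuous_RInt_param; [lra|auto|].
    intros t. apply ex_RInt_cont. intros y. now apply continuity_2d_snd. }
  assert (H0 : RInt (h s) 0 1 = 0).
  { rewrite (RInt_Rext _ (fun _ => 0)); [|intros|lra].
    - rewrite RInt_const. unfold scal; simpl; unfold mult; simpl. ring.
    - unfold h. rewrite Rmax_left by lra. ring. }
  unfold continuous in Hc. rewrite H0 in Hc.
  apply filterlim_within_ext with (fun t => RInt (h t) 0 1).
  - intros t Ht. unfold dev. apply RInt_Rext; [|lra].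
    intros y Hy. unfold h. rewrite clamp_id, Rmax_right by lra. reflexivity.
  - intros P HP. destruct (Hc P HP) as [r Hr]. exists r. intros t Ht _. now apply Hr.
Qed.

Lemma dev_derive_under_RInt (eps lam q s t : R) (uh uht : R -> R -> R) : 0 < eps -> s < t ->
  cont_on (strip_closed s) uh -> cont_on (strip_open s) uht ->
  (forall x t, 0 <= x <= 1 -> s < t -> is_derive (fun r => uh x r) t (uht x t)) ->
  is_derive (dev eps lam q uh s) t (- RInt (fun y => kg eps lam q y * uht (clamp y) t) 0 1).
Proof.
  intros He Ht Huh Huht HD.
  set (k := kg eps lam q).
  assert (Hk : forall y, continuous k y) by (intros; now apply kg_continuous).
  set (h := fun t y => k y * (uh (clamp y) s - uh (clamp y) t)).
  assert (Hd : forall r y, s < r -> is_derive (fun r => h r y) r (- (k y * uht (clamp y) r))).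
  { intros r y Hr. unfold h.
    replace (- (k y * uht (clamp y) r)) with (k y * (minus 0 (uht (clamp y) r)))
      by (unfold minus, plus, opp; simpl; ring).
    apply (is_derive_scal (fun r => uh (clamp y) s - uh (clamp y) r)).
    apply (is_derive_minus (fun _ => uh (clamp y) s) (fun r => uh (clamp y) r)).
    - apply (@is_derive_const R_AbsRing R_NormedModule).
    - apply HD; [apply clamp_range|exact Hr]. }
  assert (Hp : 0 < t - s) by lra.
  assert (Hloc : forall r, Rabs (r - t) < t - s -> s < r)
    by (intros r Hr; apply Rabs_def2 in Hr; lra).
  apply is_derive_ext with (fun t => RInt (h t) 0 1).
  { intros r. unfold dev. apply RInt_Rext; [|lra].
    intros y Hy. unfold h. rewrite clamp_id by lra. reflexivity. }
  replace (- RInt _ 0 1) with (RInt (fun y => Derive (fun r => h r y) t) 0 1).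
  - apply (is_derive_RInt_param h 0 1 t).
    + exists (mkposreal _ Hp). intros r Hr y _. eexists. apply Hd. now apply Hloc.
    + intros y _.
      apply continuity_2d_pt_ext_loc with (fun r y => (-1) * (k y * uht (clamp y) r)).
      * exists (mkposreal _ Hp). simpl. intros r z Hr _. symmetry.
        apply (eq_trans (is_derive_unique _ _ _ (Hd r z (Hloc r Hr)))). eq_R. ring.
      * apply continuity_2d_pt_mult; [apply continuity_2d_pt_const|].
        apply continuity_2d_pt_mult; [now apply continuity_2d_of_snd|].
        now apply (cont_on_strip_open s).
    + exists (mkposreal _ Hp). intros r Hr. apply Hloc in Hr.
      apply (dev_ex_RInt k (fun y => uh (clamp y) s) (fun y => uh (clamp y) r)); auto;
        intros y; apply (cont_on_strip_closed_slice s); auto; lra.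
  - rewrite (RInt_Rext _ (fun y => (-1) * (k y * uht (clamp y) t))); [|intros y _|lra].
    + rewrite RInt_Rscal; [eq_R; ring|]. apply ex_RInt_cont. intros y.
      apply cont_Rmult; auto. now apply (cont_on_strip_open_slice s).
    + apply (eq_trans (is_derive_unique _ _ _ (Hd t y Ht))). eq_R. ring.
Qed.

(* Integrability of the observer gain [p] comes from the PDE itself: if [e <> 0] the equation
   expresses [p] on ]0, 1[ through continuous functions, and otherwise [p] drops out. *)
Lemma RInt_observer_gain (G k p : R -> R) (e : R) : (forall y, continuous G y) ->
  (forall y, 0 < y < 1 -> G y = k y * (p y * e)) ->
  RInt G 0 1 = e * RInt (fun y => k y * p y) 0 1.
Proof.
  intros HG H. destruct (Req_dec e 0) as [->|He].
  - rewrite (RInt_ext _ (fun _ => 0)).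
    + rewrite RInt_const. unfold scal; simpl; unfold mult; simpl. ring.
    + rewrite Rmin_left, Rmax_right by lra. intros y Hy. rewrite H by exact Hy.
      change (k y * (p y * 0) = 0). ring.
  - rewrite (RInt_ext (fun y => k y * p y) (fun y => / e * G y)).
    + rewrite RInt_Rscal by now apply ex_RInt_cont. symmetry. eq_R. field. exact He.
    + rewrite Rmin_left, Rmax_right by lra. intros y Hy. rewrite H by exact Hy.
      change (k y * p y = / e * (k y * (p y * e))). field. exact He.
Qed.

Lemma dev_derive (eps lam q s U t : R) (u uh : R -> R -> R) : 0 < eps -> s < t ->
  held_solution eps lam q s U u uh -> U = Uctrl eps lam q uh s ->
  is_derive (dev eps lam q uh s) t
    (- eps * kg eps lam q 1 * dev eps lam q uh s t
     - RInt (fun y => (eps * ddkg eps lam q y + eps * kg eps lam q 1 * kg eps lam q y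
                       + lam * kg eps lam q y) * uh (clamp y) t) 0 1
     + (eps * q * kg eps lam q 1 + eps * dkg eps lam q 1) * uh 1 t
     - (lam * kg eps lam q 0 / 2 + RInt (fun y => kg eps lam q y * p1 eps lam q y) 0 1)
         * (u 0 t - uh 0 t)).
Proof.
  intros He Ht (ux & uxx & ut & uhx & uhxx & uht & _ & HC & Hsol) HU.
  destruct HC as (HD & Huh & Huhx & Huhxx & Huht).
  destruct (Hsol t Ht) as (Hpde & _ & _ & Hb0 & Hb1).
  destruct (kg_smooth eps lam q He) as (k1 & k2 & Hk1 & Hk2 & Hk2c & Hk10).
  assert (Ed : forall y, dkg eps lam q y = k1 y) by (intros; now apply is_derive_unique).
  assert (Edd : forall y, ddkg eps lam q y = k2 y).
  { intros y. unfold ddkg. rewrite (Derive_ext _ k1) by exact Ed. now apply is_derive_unique. }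
  set (k := kg eps lam q) in *.
  assert (Hk : forall y, continuous k y) by (intros; eapply is_derive_continuous; apply Hk1).
  assert (Hk1c : forall y, continuous k1 y) by (intros; eapply is_derive_continuous; apply Hk2).
  pose proof (fun y => cont_on_strip_closed_slice s uh t y Huh (Rlt_le _ _ Ht)) as Cf.
  pose proof (fun y => cont_on_strip_closed_slice s uh s y Huh (Rle_refl s)) as Cfs.
  pose proof (fun y => cont_on_strip_open_slice s uhx t y Huhx Ht) as Cx.
  pose proof (fun y => cont_on_strip_open_slice s uhxx t y Huhxx Ht) as Cxx.
  pose proof (fun y => cont_on_strip_open_slice s uht t y Huht Ht) as Ct.
  set (e := u 0 t - uh 0 t) in *.
  pose proof (dev_derive_under_RInt eps lam q s t uh uht He Ht Huh Huht
    (fun x t Hx Ht => proj2 (proj2 (HD x t Hx Ht)))) as Hdev.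
  fold k in Hdev.
  assert (I1 : RInt (fun y => k y * uht (clamp y) t - (eps * (k y * uhxx (clamp y) t)
       + lam * (k y * uh (clamp y) t))) 0 1 = e * RInt (fun y => k y * p1 eps lam q y) 0 1).
  { apply RInt_observer_gain.
    - intros y. apply cont_Rminus; [now apply cont_Rmult|].
      apply cont_Rplus; (apply cont_Rmult; [apply continuous_const|]); now apply cont_Rmult.
    - intros y Hy. rewrite clamp_id by lra. rewrite (proj2 (Hpde y Hy)). fold e. ring. }
  (* Both integrations by parts at once: the integrand is the derivative of [k uhx - k' uh]. *)
  assert (I2 : RInt (fun y => k y * uhxx (clamp y) t - k2 y * uh (clamp y) t) 0 1
     = (k 1 * uhx 1 t - k1 1 * uh 1 t) - (k 0 * uhx 0 t - k1 0 * uh 0 t)).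
  { rewrite (RInt_interior_derive
      (fun y => k y * uhx (clamp y) t - k1 y * uh (clamp y) t)).
    - rewrite !clamp_id by lra. reflexivity.
    - lra.
    - intros y Hy.
      replace (_ - _) with (minus
         (plus (mult (k1 y) (uhx (clamp y) t)) (mult (k y) (uhxx y t)))
         (plus (mult (k2 y) (uh (clamp y) t)) (mult (k1 y) (uhx y t)))).
      + apply (is_derive_minus (fun y => k y * uhx (clamp y) t) (fun y => k1 y * uh (clamp y) t)).
        * apply (is_derive_mult k (fun y => uhx (clamp y) t)); auto.
          -- apply (deriv01_clamp (fun y => uhx y t)); auto. apply HD; lra.
          -- intros; apply Rmult_comm.
        * apply (is_derive_mult k1 (fun y => uh (clamp y) t)); auto.
          -- apply (deriv01_clamp (fun y => uh y t)); auto. apply HD; lra.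
          -- intros; apply Rmult_comm.
      + unfold minus, plus, opp, mult; simpl. rewrite !clamp_id by lra. ring.
    - intros y. apply cont_Rminus; apply cont_Rmult; auto.
    - intros y. apply cont_Rminus; apply cont_Rmult; auto. }
  set (T0 := RInt (fun y => k y * uht (clamp y) t) 0 1 : R) in *.
  set (T1 := RInt (fun y => k y * uhxx (clamp y) t) 0 1 : R).
  set (T2 := RInt (fun y => k y * uh (clamp y) t) 0 1 : R).
  set (T3 := RInt (fun y => k2 y * uh (clamp y) t) 0 1 : R).
  assert (Exx : ex_RInt (fun y => k y * uhxx (clamp y) t) 0 1)
    by (apply ex_RInt_cont; intros; now apply cont_Rmult).
  assert (Ef : ex_RInt (fun y => k y * uh (clamp y) t) 0 1)
    by (apply ex_RInt_cont; intros; now apply cont_Rmult).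
  assert (E2 : ex_RInt (fun y => k2 y * uh (clamp y) t) 0 1)
    by (apply ex_RInt_cont; intros; now apply cont_Rmult).
  assert (Et : ex_RInt (fun y => k y * uht (clamp y) t) 0 1)
    by (apply ex_RInt_cont; intros; now apply cont_Rmult).
  rewrite RInt_Rminus, RInt_Rplus, !RInt_Rscal in I1; auto using ex_RInt_Rplus, ex_RInt_Rscal.
  rewrite RInt_Rminus in I2; auto.
  fold T0 T1 T2 in I1. fold T1 T3 in I2.
  assert (I3 : RInt (fun y => (eps * ddkg eps lam q y + eps * k 1 * k y + lam * k y)
                 * uh (clamp y) t) 0 1 = eps * T3 + (eps * k 1 + lam) * T2).
  { rewrite (RInt_Rext _ (fun y => eps * (k2 y * uh (clamp y) t)
        + (eps * k 1 + lam) * (k y * uh (clamp y) t))); [|intros; rewrite Edd; ring|lra].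
    rewrite RInt_Rplus, !RInt_Rscal; auto using ex_RInt_Rscal. }
  (* The held input is the integral of [k uh] at time [s]. The boundary term [k 1 * U] is therefore
     [k 1 * (d + T2)], the source of both [- eps * k 1 * d] and the middle term of the integrand. *)
  assert (I4 : dev eps lam q uh s t = U - T2).
  { rewrite HU. unfold dev, Uctrl. fold k.
    rewrite (RInt_Rext _ (fun y => k y * uh (clamp y) s - k y * uh (clamp y) t)).
    - rewrite RInt_Rminus; auto.
      + unfold T2. f_equal. apply RInt_Rext; [|lra]. intros. rewrite clamp_id by lra. reflexivity.
      + apply ex_RInt_cont; intros; now apply cont_Rmult.
    - intros. rewrite clamp_id by lra. ring.
    - lra. }
  rewrite I3, I4, Ed.
  replace (_ - _ * e) with (- T0); [exact Hdev|].
  assert (Hx1 : uhx 1 t = U - q * uh 1 t) by lra.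
  (* The vanishing of [k' 0] removes [uh 0 t], while the injection gain [p10] at [x = 0] produces
     the coefficient [lam * k 0 / 2]. *)
  rewrite Hk10, Hx1, Hb0 in I2. unfold p10 in I2.
  assert (HT1 : T1 = T3 + (k 1 * (U - q * uh 1 t) - k1 1 * uh 1 t + k 0 * (lam / (2 * eps) * e))).
  { transitivity (T3 + (T1 - T3)); [ring|]. rewrite I2. field. lra. }
  assert (HT0 : T0 = eps * T1 + lam * T2 + e * RInt (fun y => k y * p1 eps lam q y) 0 1) by lra.
  rewrite HT0, HT1. field. lra.
Qed.

(** Cauchy-Schwarz with the weights 1/6, 1/3, 1/3, 1/6, which sum to 1. The six squares are those of
    Lagrange's identity for these weights. *)
Lemma weighted_sum_sq (a b c d : R) :
  (a + b + c + d) ^ 2 <= 6 * a ^ 2 + 3 * b ^ 2 + 3 * c ^ 2 + 6 * d ^ 2.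
Proof.
  pose proof (pow2_ge_0 (2 * a - b)). pose proof (pow2_ge_0 (2 * a - c)).
  pose proof (pow2_ge_0 (a - d)). pose proof (pow2_ge_0 (b - c)).
  pose proof (pow2_ge_0 (b - 2 * d)). pose proof (pow2_ge_0 (c - 2 * d)). nra.
Qed.

Lemma sqnorm01_ge_0 (f : R -> R) : (forall y, continuous f y) -> 0 <= sqnorm01 f.
Proof.
  intros Hf. apply RInt_ge_0; [lra| |intros; apply pow2_ge_0].
  apply ex_RInt_cont. intros; now apply cont_pow2.
Qed.

Lemma what_transK (eps lam : R) (uh : R -> R -> R) (x t : R) : 0 <= x <= 1 ->
  what eps lam uh x t = transK eps lam (fun x => uh (clamp x) t) x.
Proof.
  intros Hx. unfold what, transK. rewrite clamp_id by lra. f_equal.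
  apply RInt_Rext; [|lra]. intros y Hy. rewrite clamp_id by lra. reflexivity.
Qed.

Lemma wtil_0 (eps lam q : R) (u uh : R -> R -> R) (t : R) :
  wtil eps lam q u uh 0 t = u 0 t - uh 0 t.
Proof. unfold wtil. rewrite RInt_point. unfold zero; simpl. ring. Qed.

(** For [beta_i = alpha_i / (1 - sigma)] the last three terms of the trigger equation are exactly
    [- forcing / (1 - sigma)]. *)
Definition forcing (eps lam q : R) (u uh : R -> R -> R) (t : R) : R :=
  alpha1 eps lam q * sqnorm01 (fun x => what eps lam uh x t)
  + alpha2 eps lam q * (what eps lam uh 1 t) ^ 2
  + alpha3 eps lam q * (wtil eps lam q u uh 0 t) ^ 2.

Lemma dev_derive_bound (eps lam q s t : R) (u uh : R -> R -> R) : 0 < eps -> 0 < lam -> s < t ->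
  held_solution eps lam q s (Uctrl eps lam q uh s) u uh ->
  0 <= forcing eps lam q u uh t /\
  exists l, is_derive (dev eps lam q uh s) t l /\
    l ^ 2 <= rho1 eps lam q * (dev eps lam q uh s t) ^ 2 + forcing eps lam q u uh t.
Proof.
  intros He Hl Ht Hsol.
  pose proof (dev_derive eps lam q s _ t u uh He Ht Hsol eq_refl) as Hd.
  destruct Hsol as (ux & uxx & ut & uhx & uhxx & uht & _ & HC & _).
  destruct HC as (_ & Huh & _).
  set (f := fun x => uh (clamp x) t).
  assert (Hf : forall y, continuous f y)
    by (intros y; apply (cont_on_strip_closed_slice s); auto; lra).
  assert (Hw : forall y, continuous (transK eps lam f) y)
    by (intros; apply transK_continuous; auto; lra).
  assert (Es : sqnorm01 (fun x => what eps lam uh x t) = sqnorm01 (transK eps lam f)).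
  { apply RInt_Rext; [|lra]. intros x Hx. now rewrite what_transK. }
  unfold forcing. rewrite Es, (what_transK eps lam uh 1 t) by lra. rewrite wtil_0. fold f.
  pose proof (sqnorm01_transK_bound eps lam f He Hl Hf) as HB.
  pose proof (transK_boundary_bound eps lam f He Hl Hf) as HBd.
  pose proof (sqnorm01_ge_0 _ Hw) as HWn.
  assert (Hf1 : f 1 = uh 1 t) by (unfold f; rewrite clamp_id by lra; reflexivity).
  rewrite Hf1 in HBd.
  unfold rho1, alpha1, alpha2, alpha3.
  set (Wn := sqnorm01 (transK eps lam f)) in *. set (w1 := transK eps lam f 1) in *.
  set (n2 := (1 + sqrt _) ^ 2) in *.
  set (L1 := RInt (fun y => (Lk eps lam 1 y) ^ 2) 0 1 : R) in *.
  set (G := fun y => eps * ddkg eps lam q y + eps * kg eps lam q 1 * kg eps lam q y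
                     + lam * kg eps lam q y) in *.
  set (c := eps * q * kg eps lam q 1 + eps * dkg eps lam q 1) in *.
  set (a3 := lam * kg eps lam q 0 / 2 + _) in *.
  set (d := dev eps lam q uh s t) in *. set (e := u 0 t - uh 0 t) in *.
  set (k := kg eps lam q 1) in *.
  assert (HG : forall y, continuous G y).
  { destruct (kg_smooth eps lam q He) as (k1 & k2 & Hk1 & Hk2 & Hk2c & _).
    intros y. apply cont_ext with (fun y => eps * k2 y + eps * k * kg eps lam q y
                                   + lam * kg eps lam q y).
    - intros z. unfold G. do 3 f_equal. unfold ddkg.
      rewrite (Derive_ext _ k1) by (intros; now apply is_derive_unique).
      symmetry. now apply is_derive_unique.
    - apply cont_Rplus; [apply cont_Rplus|]; (apply cont_Rmult; [apply continuous_const|]);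
        auto; now apply kg_continuous. }
  change (RInt (fun y => (G y) ^ 2) 0 1) with (sqnorm01 G).
  change (RInt (fun y => (eps * ddkg eps lam q y + eps * k * kg eps lam q y
                          + lam * kg eps lam q y) ^ 2) 0 1) with (sqnorm01 G).
  assert (HG2 : 0 <= sqnorm01 G) by now apply sqnorm01_ge_0.
  assert (HL1 : 0 <= L1).
  { apply (sqnorm01_ge_0 (Lk eps lam 1)). intros y. apply continuity_2d_snd, Lk_continuity_2d. lra. }
  assert (Hn2 : 0 <= n2) by apply pow2_ge_0.
  pose proof (pow2_ge_0 c) as Hc2. pose proof (pow2_ge_0 a3) as Ha3.
  pose proof (pow2_ge_0 w1) as Hw1. pose proof (pow2_ge_0 e) as He2.
  split.
  { pose proof (Rmult_le_pos _ _ (Rmult_le_pos _ _ Hn2 HG2) HWn).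
    pose proof (Rmult_le_pos _ _ (Rmult_le_pos _ _ Hc2 HL1) HWn).
    pose proof (Rmult_le_pos _ _ Hc2 Hw1). pose proof (Rmult_le_pos _ _ Ha3 He2). lra. }
  eexists. split; [exact Hd|].
  set (B := RInt (fun y => G y * f y) 0 1 : R).
  assert (HBB : B ^ 2 <= sqnorm01 G * (n2 * Wn)).
  { apply Rle_trans with (sqnorm01 G * sqnorm01 f).
    - now apply (RInt_cauchy_schwarz G f 0 1); [lra| |].
    - now apply Rmult_le_compat_l. }
  assert (HCC : (c * uh 1 t) ^ 2 <= c ^ 2 * (2 * w1 ^ 2 + 2 * (L1 * Wn))).
  { rewrite Rpow_mult_distr. now apply Rmult_le_compat_l. }
  match goal with |- ?l ^ 2 <= _ =>
    replace l with (- eps * k * d + - B + c * uh 1 t + - a3 * e) by (unfold B, G, f; ring) end.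
  (* The weights 6 go to the terms in [d] and [e], which become [rho1] and [alpha3]; the weights 3
     go to the integral and to the boundary value, which still have to be expressed through [wh]. *)
  eapply Rle_trans; [apply weighted_sum_sq|].
  replace ((- eps * k * d) ^ 2) with (eps ^ 2 * k ^ 2 * d ^ 2) by ring.
  replace ((- B) ^ 2) with (B ^ 2) by ring.
  replace ((- a3 * e) ^ 2) with (a3 ^ 2 * e ^ 2) by ring.
  lra.
Qed.

(** * The triggering variable *)

(** Selects the last zero before [b], after which [f] stays positive: the differential inequality
    for [psi] is known only where [psi >= 0]. *)
Lemma last_nonpos (f : R -> R) (a b : R) : a <= b -> (forall t, a <= t <= b -> continuous f t) ->
  f a <= 0 -> 0 < f b -> exists c, a <= c < b /\ f c = 0 /\ forall t, c < t <= b -> 0 < f t.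
Proof.
  intros Hab Hf Ha Hb.
  destruct (completeness (fun t => a <= t <= b /\ f t <= 0)) as [c [Hub Hlub]].
  - exists b. intros t [Ht _]. lra.
  - exists a. split; [lra|exact Ha].
  - assert (Hac : a <= c) by (apply Hub; split; [lra|exact Ha]).
    assert (Hcb : c <= b) by (apply Hlub; intros t [Ht _]; lra).
    assert (Hpos : forall t, c < t <= b -> 0 < f t).
    { intros t Ht. apply Rnot_le_lt. intros H. apply (Rlt_not_le t c); [lra|].
      apply Hub. split; [lra|exact H]. }
    pose proof (proj1 (filterlim_locally _ _) (Hf c (conj Hac Hcb))) as Hc.
    assert (Hle : f c <= 0).
    { apply Rnot_lt_le. intros H. destruct (Hc (mkposreal _ H)) as [d Hd].
      apply (Rlt_not_le c (c - d)); [pose proof (cond_pos d); lra|].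
      apply Hlub. intros t [Ht Hft]. apply Rnot_lt_le. intros Hlt.
      assert (Htc : t <= c) by (apply Hub; split; [lra|exact Hft]).
      assert (HB : Rabs (f t - f c) < f c).
      { apply Hd. change (Rabs (t - c) < d). apply Rabs_def1; lra. }
      apply Rabs_def2 in HB. lra. }
    assert (Hcb' : c < b) by (destruct (Req_dec c b); [subst; lra|lra]).
    exists c. split; [lra|]. split; [|exact Hpos].
    apply Rle_antisym; [exact Hle|]. apply Rnot_lt_le. intros H.
    assert (H' : 0 < - f c) by lra. destruct (Hc (mkposreal _ H')) as [d Hd].
    set (t := Rmin b (c + d / 2)). pose proof (cond_pos d).
    assert (Ht : c < t <= b) by (split; [apply Rmin_glb_lt; lra|apply Rmin_l]).
    assert (t <= c + d / 2) by apply Rmin_r.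
    assert (HB : Rabs (f t - f c) < - f c).
    { apply Hd. change (Rabs (t - c) < d). apply Rabs_def1; lra. }
    apply Rabs_def2 in HB. pose proof (Hpos t Ht). lra.
Qed.

(** With the integrating factor, [exp (c t) * m t] is nonincreasing, so a negative value stays
    negative, right end included. *)
Lemma growth_negative (m dm : R -> R) (c a b : R) : a <= b ->
  (forall t, a <= t <= b -> is_derive m t (dm t)) ->
  (forall t, a < t < b -> dm t <= - c * m t) -> m a < 0 -> m b < 0.
Proof.
  intros Hab Hm Hle Ha.
  destruct (Req_dec a b) as [<-|Hne]; [exact Ha|].
  set (g := fun t => exp (c * t) * m t).
  set (dg := fun t => exp (c * t) * (c * m t + dm t)).
  assert (Hg : forall t, a <= t <= b -> is_derive g t (dg t)).
  { intros t Ht. unfold g, dg. auto_derive.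
    - exists (dm t). now apply Hm.
    - rewrite (Derive_eta m t (dm t)) by now apply Hm. ring. }
  assert (Hmon : g b <= g a).
  { apply (Rle_trans _ (g a + 0)); [|lra].
    destruct (MVT_cor2 g dg a b) as [x [Hx1 Hx2]]; [lra| |].
    - intros t Ht. apply is_derive_Reals, Hg. exact Ht.
    - assert (dg x <= 0).
      { unfold dg. pose proof (exp_pos (c * x)). pose proof (Hle x Hx2).
        assert (c * m x + dm x <= 0) by lra. nra. }
      assert (dg x * (b - a) <= 0) by nra. lra. }
  unfold g in Hmon. pose proof (exp_pos (c * b)). pose proof (exp_pos (c * a)).
  assert (exp (c * a) * m a < 0) by nra.
  apply Rnot_le_lt. intros Hmb. assert (0 <= exp (c * b) * m b) by nra. lra.
Qed.

(* [int_0^1 ds / P s] is the time needed by the solution of [psi' = P psi] to grow from [0] to [1]. *)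
Lemma comparison_time (psi dpsi P : R -> R) (a b : R) : a <= b ->
  (forall t, a <= t <= b -> is_derive psi t (dpsi t)) ->
  (forall t, a < t < b -> 0 <= psi t -> dpsi t <= P (psi t)) ->
  (forall x, continuous P x) -> (forall x, 0 <= x -> 0 < P x) ->
  psi a <= 0 -> psi b = 1 -> RInt (fun x => / P x) 0 1 <= b - a.
Proof.
  intros Hab Hd Hle HPc HP Ha Hb.
  destruct (last_nonpos psi a b) as (c & Hc & Hc0 & Hpos); auto.
  { intros t Ht. eapply is_derive_continuous. now apply Hd. }
  { lra. }
  (* [P] is known to be positive only on nonnegative arguments; [Rmax 0] makes the reciprocal
     continuous everywhere without changing it on [[0, 1]]. *)
  set (g := fun x => / P (Rmax 0 x)).
  assert (Hg : forall x, continuous g x).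
  { intros x. apply (continuous_comp (fun x => P (Rmax 0 x)) Rinv).
    - apply (continuous_comp (Rmax 0) P); [apply Rmax_continuous|apply HPc].
    - apply continuous_Rinv. pose proof (HP _ (Rmax_l 0 x)). lra. }
  assert (HG : forall x, is_derive (RInt g 0) x (g x)).
  { intros x. apply (is_derive_RInt g _ 0); [|apply Hg].
    exists (mkposreal 1 Rlt_0_1). intros y _.
    apply (@RInt_correct R_CompleteNormedModule), ex_RInt_cont, Hg. }
  assert (HGp : forall t, a <= t <= b ->
     is_derive (fun t => RInt g 0 (psi t)) t (dpsi t * g (psi t))).
  { intros t Ht. apply (is_derive_comp (RInt g 0) psi); [apply HG|now apply Hd]. }
  (* The primitive of [1 / P] along [psi] grows at rate [psi' / P psi <= 1], and by the integral
     from [0] to [1] in total between [c] and [b]. *)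
  destruct (MVT_cor2 (fun t => RInt g 0 (psi t)) (fun t => dpsi t * g (psi t)) c b)
    as [x [Hx1 Hx2]]; [lra| |].
  { intros t Ht. apply is_derive_Reals, HGp. lra. }
  simpl in Hx1. rewrite Hb, Hc0, RInt_point in Hx1. unfold zero in Hx1; simpl in Hx1.
  assert (Hpx : 0 < psi x) by (apply Hpos; lra).
  assert (Hone : dpsi x * g (psi x) <= 1).
  { unfold g. rewrite Rmax_right by lra. pose proof (HP (psi x) (Rlt_le _ _ Hpx)).
    apply Rmult_le_reg_r with (P (psi x)); [assumption|].
    rewrite Rmult_assoc, Rinv_l, Rmult_1_r, Rmult_1_l by lra.
    apply Hle; lra. }
  rewrite (RInt_Rext _ g); [|intros y Hy; unfold g; now rewrite Rmax_right by lra|lra].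
  assert (dpsi x * g (psi x) * (b - c) <= 1 * (b - c)) by (apply Rmult_le_compat_r; lra).
  lra.
Qed.

(** With [E = 1 - sigma + sigma * s], this is the expansion of
    [E * (1 + r + eta + rho * E) / sigma]. *)
Definition growth_rate (r eta rho sigma s : R) : R :=
  sigma * rho * s ^ 2 + (1 + r + 2 * (1 - sigma) * rho + eta) * s
  + (1 + r + (1 - sigma) * rho + eta) * (1 - sigma) / sigma.

Lemma growth_rate_pos (r eta rho sigma s : R) : 0 <= r -> 0 < eta -> 0 < rho -> 0 < sigma < 1 ->
  0 <= s -> 0 < growth_rate r eta rho sigma s.
Proof.
  intros Hr Heta Hrho Hsig Hs. unfold growth_rate.
  assert (0 < sigma * rho) by nra. assert (0 < (1 - sigma) * rho) by nra.
  assert (0 < (1 + r + (1 - sigma) * rho + eta) * (1 - sigma) / sigma).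
  { apply Rdiv_lt_0_compat; [|lra]. apply Rmult_lt_0_compat; lra. }
  assert (0 <= sigma * rho * s ^ 2) by (apply Rmult_le_pos; [lra|apply pow2_ge_0]).
  assert (0 <= (1 + r + 2 * (1 - sigma) * rho + eta) * s) by (apply Rmult_le_pos; lra).
  lra.
Qed.

Lemma growth_rate_continuous (r eta rho sigma s : R) : continuous (growth_rate r eta rho sigma) s.
Proof.
  unfold growth_rate. eapply is_derive_continuous.
  instantiate (1 := sigma * rho * (2 * s) + (1 + r + 2 * (1 - sigma) * rho + eta)).
  auto_derive; [auto|ring].
Qed.

(** Here [D] stands for [d^2], [S] for the forcing and [r] for [rho1]. The conditions at the ends
    say [psi a <= 0] and [psi b = 1]. *)
Lemma trigger_dwell_time (m D dD S : R -> R) (r eta rho sigma a b : R) :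
  a <= b -> 0 <= r -> 0 < eta -> 0 < rho -> 0 < sigma < 1 ->
  (forall t, a <= t <= b -> is_derive m t (- eta * m t + rho * D t - S t / (1 - sigma))) ->
  (forall t, a <= t <= b -> is_derive D t (dD t)) ->
  (forall t, a <= t <= b -> 0 <= S t /\ dD t <= (1 + r) * D t + S t) ->
  (forall t, a <= t <= b -> m t < 0) ->
  D a <= - (1 - sigma) * m a -> D b = - m b ->
  RInt (fun s => / growth_rate r eta rho sigma s) 0 1 <= b - a.
Proof.
  intros Hab Hr Heta Hrho Hsig Hm HD HS Hneg Ha Hb.
  set (psi := fun t => (D t + (1 - sigma) * m t) / (- sigma * m t)).
  set (dm := fun t => - eta * m t + rho * D t - S t / (1 - sigma)) in *.
  (* The quotient rule with the numerator of [psi] written back through [psi]; the bracket is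
     [D' + E m'] for the [E] introduced below. *)
  set (dpsi := fun t => (dD t + (1 - sigma) * dm t + sigma * psi t * dm t) / (- sigma * m t)).
  set (P := growth_rate r eta rho sigma).
  apply (comparison_time psi dpsi P a b Hab).
  - intros t Ht. pose proof (Hneg t Ht). unfold dpsi, psi. auto_derive.
    + repeat split; [eexists; now apply HD|eexists; now apply Hm|eexists; now apply Hm|nra].
    + rewrite (Derive_eta m t (dm t)) by now apply Hm.
      rewrite (Derive_eta D t (dD t)) by now apply HD.
      field. split; [lra|nra].
  - intros t Ht Hpsi. assert (Ht' : a <= t <= b) by lra.
    pose proof (Hneg t Ht') as HM. destruct (HS t Ht') as [HS0 HSD].
    set (x := psi t) in *.
    set (E := 1 - sigma + sigma * x).
    assert (HDx : D t = - m t * E).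
    { unfold E, x, psi. field. split; [lra|nra]. }
    assert (HE : 1 - sigma <= E) by (unfold E; nra).
    (* The role of [psi >= 0]: it gives [E >= 1 - sigma], so the forcing in [E m'] outweighs the one
       in [D']. *)
    assert (HSE : S t <= E * (S t / (1 - sigma))).
    { apply Rle_trans with ((1 - sigma) * (S t / (1 - sigma))).
      - right. field. lra.
      - apply Rmult_le_compat_r; [|exact HE].
        apply Rmult_le_pos; [exact HS0|]. apply Rlt_le, Rinv_0_lt_compat. lra. }
    assert (Hsm : 0 < - sigma * m t) by nra.
    unfold dpsi. fold x. apply Rmult_le_reg_r with (- sigma * m t); [exact Hsm|].
    unfold Rdiv at 1. rewrite Rmult_assoc, Rinv_l, Rmult_1_r by lra.
    replace (P x * (- sigma * m t))
      with ((1 + r) * D t + E * (- eta * m t + rho * D t)).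
    + unfold dm. replace (_ + sigma * x * _) with
        (dD t + E * (- eta * m t + rho * D t) - E * (S t / (1 - sigma))) by (unfold E; ring).
      lra.
    + rewrite HDx. unfold P, growth_rate, E. field. lra.
  - intros x. apply growth_rate_continuous.
  - intros x Hx. now apply growth_rate_pos.
  - unfold psi. assert (HM : m a < 0) by (apply Hneg; lra).
    assert (0 < - sigma * m a) by nra.
    apply Rmult_le_reg_r with (- sigma * m a); [assumption|].
    unfold Rdiv. rewrite Rmult_assoc, Rinv_l, Rmult_1_r by lra. lra.
  - unfold psi. assert (HM : m b < 0) by (apply Hneg; lra). rewrite Hb. field.
    split; lra.
Qed.

(** * The dwell time between events *)

Lemma rho1_ge_0 (eps lam q : R) : 0 <= rho1 eps lam q.
Proof.
  unfold rho1. apply Rmult_le_pos; [|apply pow2_ge_0].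
  apply Rmult_le_pos; [lra|apply pow2_ge_0].
Qed.

Lemma dwell_tau_pos (eps lam q eta rho sigma : R) : 0 < eta -> 0 < rho -> 0 < sigma < 1 ->
  0 < dwell_tau eps lam q eta rho sigma.
Proof.
  intros Heta Hrho Hsig.
  change (0 < RInt (fun s => / growth_rate (rho1 eps lam q) eta rho sigma s) 0 1).
  assert (HP : forall x, 0 <= x -> 0 < growth_rate (rho1 eps lam q) eta rho sigma x)
    by (intros; apply growth_rate_pos; auto using rho1_ge_0).
  apply RInt_gt_0; [lra| |].
  - intros x Hx. apply Rinv_0_lt_compat, HP. lra.
  - intros x Hx. apply (continuous_comp (growth_rate (rho1 eps lam q) eta rho sigma) Rinv).
    + apply growth_rate_continuous.
    + apply continuous_Rinv. pose proof (HP x (proj1 Hx)). lra.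
Qed.

(** The infimum itself may fail to be a triggering time. What remains is a triggering time in every
    [[b, b + d[], since otherwise [b + d] would be a larger lower bound. *)
Lemma glb_trigger_after (E : R -> Prop) (s b : R) :
  Glb_Rbar (fun t => s < t /\ E t) = Finite b ->
  s <= b /\ (forall t, s < t < b -> ~ E t) /\
  (forall d, 0 < d -> exists t, b <= t < b + d /\ s < t /\ E t).
Proof.
  intros HG. pose proof (Glb_Rbar_correct (fun t => s < t /\ E t)) as [Hlb Hglb].
  rewrite HG in Hlb, Hglb.
  split; [|split].
  - apply (Hglb (Finite s)). intros t [Ht _]. simpl. lra.
  - intros t Ht HE. pose proof (Hlb t (conj (proj1 Ht) HE)) as H. simpl in H. lra.
  - intros d Hd. apply Classical_Prop.NNPP. intros Hn.
    assert (H : Rbar_le (b + d) b).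
    { apply (Hglb (Finite (b + d))). intros t [Ht HE]. simpl.
      apply Rnot_lt_le. intros Hlt. apply Hn. exists t.
      pose proof (Hlb t (conj Ht HE)) as H. simpl in H. repeat split; try assumption; lra. }
    simpl in H. lra.
Qed.

(** From [2 d d' <= d^2 + d'^2]; this is the origin of the 1 in [1 + rho1]. *)
Lemma dev_sq_derive (eps lam q s t : R) (u uh : R -> R -> R) : 0 < eps -> 0 < lam -> s < t ->
  held_solution eps lam q s (Uctrl eps lam q uh s) u uh ->
  is_derive (fun t => (dev eps lam q uh s t) ^ 2) t
    (2 * dev eps lam q uh s t * Derive (dev eps lam q uh s) t) /\
  0 <= forcing eps lam q u uh t /\
  2 * dev eps lam q uh s t * Derive (dev eps lam q uh s) t
    <= (1 + rho1 eps lam q) * (dev eps lam q uh s t) ^ 2 + forcing eps lam q u uh t.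
Proof.
  intros He Hl Ht Hsol.
  destruct (dev_derive_bound eps lam q s t u uh He Hl Ht Hsol) as (HF & l & Hd & Hb).
  rewrite (is_derive_unique _ _ _ Hd). set (d := dev eps lam q uh s) in *.
  split; [|split; [exact HF|]].
  - auto_derive; [eexists; exact Hd|].
    rewrite (Derive_eta d t l Hd). ring.
  - pose proof (pow2_ge_0 (d t - l)). nra.
Qed.

Lemma interval_dwell_time (eps lam q eta rho sigma s b : R) (u uh : R -> R -> R) (m : R -> R) :
  0 < eps -> 0 < lam -> 0 < eta -> 0 < rho -> 0 < sigma < 1 -> m s < 0 ->
  held_solution eps lam q s (Uctrl eps lam q uh s) u uh ->
  filterlim m (at_right s) (locally (m s)) ->
  (forall t, s < t -> is_derive m t
     (- eta * m t + rho * (dev eps lam q uh s t) ^ 2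
      - alpha1 eps lam q / (1 - sigma) * sqnorm01 (fun x => what eps lam uh x t)
      - alpha2 eps lam q / (1 - sigma) * (what eps lam uh 1 t) ^ 2
      - alpha3 eps lam q / (1 - sigma) * (wtil eps lam q u uh 0 t) ^ 2)) ->
  Glb_Rbar (fun t => s < t /\ - m t < (dev eps lam q uh s t) ^ 2) = Finite b ->
  m b < 0 /\ dwell_tau eps lam q eta rho sigma <= b - s.
Proof.
  intros He Hl Heta Hrho Hsig Hms Hsol Hmr Hm HG.
  destruct (glb_trigger_after _ _ _ HG) as (Hsb & Hbefore & Hafter).
  set (d := dev eps lam q uh s) in *.
  set (F := forcing eps lam q u uh).
  assert (Hm' : forall t, s < t ->
     is_derive m t (- eta * m t + rho * (d t) ^ 2 - F t / (1 - sigma))).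
  { intros t Ht. pose proof (Hm t Ht) as H.
    replace (- eta * m t + rho * (d t) ^ 2 - F t / (1 - sigma)) with
     (- eta * m t + rho * (d t) ^ 2
      - alpha1 eps lam q / (1 - sigma) * sqnorm01 (fun x => what eps lam uh x t)
      - alpha2 eps lam q / (1 - sigma) * (what eps lam uh 1 t) ^ 2
      - alpha3 eps lam q / (1 - sigma) * (wtil eps lam q u uh 0 t) ^ 2); [exact H|].
    unfold F, forcing. field. lra. }
  pose proof (fun t Ht => dev_sq_derive eps lam q s t u uh He Hl Ht Hsol) as Hd2.
  fold d in Hd2.
  assert (Hdr : filterlim d (at_right s) (locally 0)).
  { apply dev_at_right; [exact He|].
    destruct Hsol as (ux & uxx & ut & uhx & uhxx & uht & _ & HC & _). apply HC. }
  (* Just after the event [d] is near [0] and [m] near [m s < 0], so [psi < 0] and no trigger fires.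
     The bound [e <= 1] lets [|d| < e] imply [d^2 < e]. *)
  assert (Hnear : exists r : posreal, forall t, s < t < s + r ->
     m t < 0 /\ (d t) ^ 2 < - (1 - sigma) * m t).
  { assert (H1 : 0 < - m s / 2) by lra.
    destruct (proj1 (filterlim_locally _ _) Hmr (mkposreal _ H1)) as [r1 Hr1].
    set (e := Rmin 1 ((1 - sigma) * (- m s / 2))).
    assert (He0 : 0 < e).
    { apply Rmin_glb_lt; [lra|]. apply Rmult_lt_0_compat; lra. }
    destruct (proj1 (filterlim_locally _ _) Hdr (mkposreal _ He0)) as [r2 Hr2].
    assert (Hr : 0 < Rmin r1 r2) by (apply Rmin_glb_lt; apply cond_pos).
    exists (mkposreal _ Hr). intros t Ht. simpl in Ht.
    pose proof (Rmin_l r1 r2). pose proof (Rmin_r r1 r2).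
    assert (B1 : Rabs (m t - m s) < - m s / 2).
    { apply (Hr1 t); [|lra]. change (Rabs (t - s) < r1). apply Rabs_def1; lra. }
    assert (B2 : Rabs (d t - 0) < e).
    { apply (Hr2 t); [|lra]. change (Rabs (t - s) < r2). apply Rabs_def1; lra. }
    rewrite Rminus_0_r in B2.
    apply Rabs_def2 in B1. split; [lra|].
    pose proof (Rmin_l 1 ((1 - sigma) * (- m s / 2))) as E1.
    pose proof (Rmin_r 1 ((1 - sigma) * (- m s / 2))) as E2. fold e in E1, E2.
    rewrite <- pow2_abs. pose proof (Rabs_pos (d t)).
    assert ((Rabs (d t)) ^ 2 < e) by nra.
    assert ((1 - sigma) * (- m s / 2) < (1 - sigma) * (- m t))
      by (apply Rmult_lt_compat_l; lra).
    lra. }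
  destruct Hnear as [r Hr].
  assert (Hsb' : s + r <= b).
  { apply Rnot_lt_le. intros Hlt.
    destruct (Hafter (s + r - b)) as (t & Ht1 & Ht2 & Ht3); [lra|].
    destruct (Hr t) as [H1 H2]; [lra|]. simpl in Ht3. nra. }
  pose proof (cond_pos r) as Hr0.
  assert (Hbef : forall t, s < t < b -> (d t) ^ 2 <= - m t).
  { intros t Ht. apply Rnot_lt_le. intros H. now apply (Hbefore t Ht). }
  (* Before the trigger [d^2 <= - m] gives [m' <= - (eta + rho) m]. The start [t0] lies before [t]
     and within the window where [m < 0] is already known. *)
  assert (Hneg : forall t, s < t <= b -> m t < 0).
  { intros t Ht.
    set (t0 := s + Rmin r (t - s) / 2).
    assert (0 < Rmin r (t - s)) by (apply Rmin_glb_lt; lra).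
    pose proof (Rmin_l r (t - s)). pose proof (Rmin_r r (t - s)).
    apply (growth_negative m (fun t => - eta * m t + rho * (d t) ^ 2 - F t / (1 - sigma))
             (eta + rho) t0 t).
    - unfold t0; lra.
    - intros z Hz. apply Hm'. unfold t0 in Hz; lra.
    - intros z Hz. assert (Hz' : s < z < b) by (unfold t0 in Hz; lra).
      pose proof (Hbef z Hz') as H3.
      assert (0 <= F z / (1 - sigma)).
      { apply Rmult_le_pos; [apply Hd2; lra|]. apply Rlt_le, Rinv_0_lt_compat; lra. }
      assert (rho * (d z) ^ 2 <= rho * - m z) by (apply Rmult_le_compat_l; lra). lra.
    - apply Hr. unfold t0; lra. }
  split; [apply Hneg; lra|].
  assert (Hcont : continuous (fun t => (d t) ^ 2 + m t) b).
  { apply cont_Rplus; eapply is_derive_continuous; [apply Hd2|apply Hm']; lra. }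
  (* By continuity: [d^2 < - m] at [b] would exclude triggering times shortly after [b], and
     [d^2 > - m] would force some before it. *)
  assert (Hb : (d b) ^ 2 = - m b).
  { destruct (Rtotal_order ((d b) ^ 2 + m b) 0) as [H|[H|H]]; [exfalso|lra|exfalso].
    - assert (H' : 0 < - ((d b) ^ 2 + m b)) by lra.
      destruct (proj1 (filterlim_locally _ _) Hcont (mkposreal _ H')) as [z Hz].
      destruct (Hafter z (cond_pos z)) as (t & Ht1 & Ht2 & Ht3).
      assert (HB : Rabs (((d t) ^ 2 + m t) - ((d b) ^ 2 + m b)) < - ((d b) ^ 2 + m b)).
      { apply Hz. change (Rabs (t - b) < z). apply Rabs_def1; pose proof (cond_pos z); lra. }
      apply Rabs_def2 in HB. lra.
    - destruct (proj1 (filterlim_locally _ _) Hcont (mkposreal _ H)) as [z Hz].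
      pose proof (cond_pos z) as Hz0.
      set (t := b - Rmin z r / 2).
      assert (0 < Rmin z r) by (apply Rmin_glb_lt; lra).
      pose proof (Rmin_l z r). pose proof (Rmin_r z r).
      assert (HB : Rabs (((d t) ^ 2 + m t) - ((d b) ^ 2 + m b)) < (d b) ^ 2 + m b).
      { apply Hz. change (Rabs (t - b) < z). apply Rabs_def1; unfold t; lra. }
      apply Rabs_def2 in HB. assert (Ht : s < t < b) by (unfold t; lra).
      pose proof (Hbef t Ht). lra. }
  (* Starting at [s + r / 2] provides derivatives at the left end as well, with [psi < 0] there. *)
  apply Rle_trans with (b - (s + r / 2)); [|lra].
  apply (trigger_dwell_time m (fun t => (d t) ^ 2) (fun t => 2 * d t * Derive d t) F
           (rho1 eps lam q)); try assumption.
  - lra.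
  - apply rho1_ge_0.
  - intros t Ht. apply Hm'. lra.
  - intros t Ht. apply Hd2. lra.
  - intros t Ht. apply Hd2. lra.
  - intros t Ht. apply Hneg. lra.
  - apply Rlt_le, Hr. lra.
Qed.

Theorem theorem1 (eps lam q eta rho sigma : R) (tev : nat -> Rbar)
    (u uh : nat -> R -> R -> R) (m : nat -> R -> R) :
  0 < eps -> 0 < lam -> (lam + eps) / (2 * eps) < q ->
  0 < eta -> 0 < rho -> 0 < sigma < 1 ->
  ETC_closed_loop eps lam q eta rho
    (alpha1 eps lam q / (1 - sigma)) (alpha2 eps lam q / (1 - sigma))
    (alpha3 eps lam q / (1 - sigma)) tev u uh m ->
  0 < dwell_tau eps lam q eta rho sigma /\
  (forall (j : nat) (tj tj1 : R), tev j = Finite tj -> tev (S j) = Finite tj1 ->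
     dwell_tau eps lam q eta rho sigma <= tj1 - tj).
Proof.
  intros He Hl _ Heta Hrho Hsig (H0 & Hm0 & Hstep).
  split; [now apply dwell_tau_pos|].
  assert (Hint : forall j tj tj1, tev j = Finite tj -> tev (S j) = Finite tj1 -> m j tj < 0 ->
     m (S j) tj1 < 0 /\ dwell_tau eps lam q eta rho sigma <= tj1 - tj).
  { intros j tj tj1 Hj Hj1 Hneg. pose proof (Hstep j) as Hs. rewrite Hj in Hs.
    destruct Hs as (Hsol & Hmr & Hode & Hev & Hnext).
    rewrite Hj1 in Hev. destruct (Hnext tj1 Hj1) as [-> _].
    now apply (interval_dwell_time eps lam q eta rho sigma tj tj1 (u j) (uh j) (m j)). }
  (* Induction over the events: [m (S j)] starts from the final value of [m j], and no finite event
     time follows an infinite one. *)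
  assert (Hneg : forall j tj, tev j = Finite tj -> m j tj < 0).
  { induction j as [|j IH]; intros tj Hj.
    - rewrite H0 in Hj. now injection Hj as <-.
    - destruct (tev j) as [tp| |] eqn:Hp.
      + now apply (Hint j tp tj Hp Hj), IH.
      + pose proof (Hstep j) as Hs. rewrite Hp, Hj in Hs. discriminate.
      + pose proof (Hstep j) as Hs. rewrite Hp, Hj in Hs. discriminate. }
  intros j tj tj1 Hj Hj1. apply (Hint j tj tj1 Hj Hj1). now apply Hneg.
Qed.
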